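(* Let $\mathcal{X}\subseteq\{0,1\}^n$ and let $X$ be a random vector with values in $\mathcal{X}$ and law $\mu$ satisfying the stochastic covering property (SCP). Consider the following three situations. (i) $Q$ is any kernel on $\mathcal{X}$ reversible with respect to $\mu$ and $\rho_0=\min_{x,y\in\mathcal{X},\,x\sim y}\max(Q_x(y),Q_y(x))$, assumed to be positive. (ii) $\rho_0=1/n$, and $Q$ is a suitable kernel reversible with respect to $\mu$ such that for all $x\in\mathcal{X}$, $Q_x(\cdot)$ is supported on $\{y\in\mathcal{X}\colon y\sim x\}$ and $\sum_{y\in\mathcal{X}\setminus\{x\}}Q_x(y)\le1$. (iii) $\mu$ is supported on $\{x\in\mathcal{X}\colon\sum_{i=1}^n x_i=k\}$ for some $k\ge1$, $\rho_0=1/(2k)$, and $Q$ is a suitable kernel reversible with respect to $\mu$ such that $Q_x(\cdot)$ is supported on $\{y\in\mathcal{X}\colon x \text{ and } y \text{ differ by a transposition of two coordinates}\}$ and $\sum_{y\in\mathcal{X}\setminus\{x\}}Q_x(y)\le1$. In situation (i) for every such $Q$, and in situations (ii) and (iii) for some kernel $Q$ with the listed properties, the following holds: for every $p\in(1,2]$ the Beckner inequality $$\alpha_p\bigl(\mu(f^p)-\mu(f)^p\bigr)\le\frac p2\,\mathcal{E}(f,f^{p-1}),\qquad \mathcal{E}(f,g)=\frac12\sum_{x,y\in\mathcal{X}}(f(y)-f(x))(g(y)-g(x))Q_x(y)\mu(x),$$ is satisfied for all $f\colon\mathcal{X}\to[0,\infty)$ with $\alpha_p\ge\rho_0/6$,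 and for any function $f\colon\mathcal{X}\to\mathbb{R}$ and $r\ge2$, $$\|(f(X)-\mathbb{E}f(X))_+\|_r\le K\sqrt r\,\Bigl\|\Bigl(\sum_{y\in\mathcal{X}}(f(y)-f(X))_-^2\,Q_X(y)\Bigr)^{1/2}\Bigr\|_r,\qquad K=\sqrt{\frac{3\sqrt e}{\rho_0(\sqrt e-1)}}.$$
   Context: For $x,y\in\{0,1\}^m$ say $x$ covers $y$, $x\rhd y$, if $x=y$ or $x=y+e_i$ for some $i$ ($e_i$ the standard basis vectors). For probability measures $\nu_1,\nu_2$ on such a space, $\nu_1\rhd\nu_2$ if there is a coupling of $\nu_1,\nu_2$ supported on $\{(x,y)\colon x\rhd y\}$. For $I\subseteq[n]$ write $X_I=(X_i)_{i\in I}$. The law $\mu$ of $X$ satisfies the SCP if for every $I\subseteq[n]$ and $x,y\in\{0,1\}^I$ with $\mathbb{P}(X_I=x),\mathbb{P}(X_I=y)>0$ and $x\rhd y$, one has $\mathbb{P}(X_{I^c}\in\cdot\,|X_I=y)\rhd\mathbb{P}(X_{I^c}\in\cdot\,|X_I=x)$. The relation $x\sim y$ on $\mathcal{X}$ means that $x$ and $y$ differ at a single coordinate or by a transposition of two coordinates. A kernel $Q$ assigns to each $x\in\mathcal{X}$ a nonnegative measure $Q_x(\cdot)$ on $\mathcal{X}$; reversible means $Q_x(y)\mu(x)=Q_y(x)\mu(y)$ for all $x,y$. $\mu(f)=\sum_x f(x)\mu(x)$; $\|Y\|_r=(\mathbb{E}|Y|^r)^{1/r}$; $t_+=\max(t,0)$,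 $t_-=\max(-t,0)$. By a theorem of Hermon and Salez, in each situation (for suitable $Q$ in (ii), (iii)) the modified log-Sobolev inequality $\rho_0\bigl(\mu(f\log f)-\mu(f)\log\mu(f)\bigr)\le\mathcal{E}(f,\log f)$, $f>0$, holds with the indicated $\rho_0$. *)

(* Defs.v *)
From HB Require Import structures.
From mathcomp Require Import all_boot all_order all_algebra all_fingroup.
From mathcomp Require Import reals sequences exp.

Set Implicit Arguments.
Unset Strict Implicit.
Unset Printing Implicit Defensive.

Import Order.TTheory GRing.Theory Num.Theory.
Local Open Scope ring_scope.

Definition cube (T : finType) := {ffun T -> bool}.

(* x = y or x = y + e_i; the addition is that of nat, not addition mod 2 *)
Definition covers (T : finType) (x y : cube T) : bool :=
  (x == y) || [exists i, forall j, x j == (y j + (j == i))%N :> nat].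

Definition measure_covers (R : realType) (T : finType)
    (nu1 nu2 : cube T -> R) : Prop :=
  exists pi : cube T -> cube T -> R,
    [/\ forall x y, 0 <= pi x y,
        forall x, \sum_y pi x y = nu1 x,
        forall y, \sum_x pi x y = nu2 y
      & forall x y, pi x y != 0 -> covers x y].

Definition coords (T : finType) (I : {set T}) : finType := {i : T | i \in I}.

Definition restr (T : finType) (I : {set T}) (z : cube T) : cube (coords I) :=
  [ffun i => z (val i)].

(* mu x = P(X = x) for a random vector X with values in the set XX *)
Definition is_law (R : realType) (n : nat) (XX : {set cube 'I_n})
    (mu : cube 'I_n -> R) : Prop :=
  [/\ forall x, 0 <= mu x,
      forall x, x \notin XX -> mu x = 0
    & \sum_x mu x = 1].

(* P(X_I = x) *)
Definition marginal (R : realType) (n : nat) (mu : cube 'I_n -> R)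
    (I : {set 'I_n}) (x : cube (coords I)) : R :=
  \sum_(z | restr I z == x) mu z.

(* w |-> P(X_{I^c} = w | X_I = x) *)
Definition cond_law (R : realType) (n : nat) (mu : cube 'I_n -> R)
    (I : {set 'I_n}) (x : cube (coords I)) (w : cube (coords (~: I))) : R :=
  (\sum_(z | (restr I z == x) && (restr (~: I) z == w)) mu z) / marginal mu x.

Definition SCP (R : realType) (n : nat) (mu : cube 'I_n -> R) : Prop :=
  forall (I : {set 'I_n}) (x y : cube (coords I)),
    0 < marginal mu x -> 0 < marginal mu y -> covers x y ->
    measure_covers (cond_law mu y) (cond_law mu x).

Definition differ_flip (n : nat) (x y : cube 'I_n) : bool :=
  [exists i, forall j, (x j != y j) == (j == i)].

Definition differ_transp (n : nat) (x y : cube 'I_n) : bool :=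
  (x != y) && [exists i, exists j, y == [ffun l => x (tperm i j l)]].

Definition adj (n : nat) (x y : cube 'I_n) : bool :=
  differ_flip x y || differ_transp x y.

Section Kernels.
Variables (R : realType) (n : nat) (XX : {set cube 'I_n}).
Variables (mu : cube 'I_n -> R) (Q : cube 'I_n -> cube 'I_n -> R).

(* Q x y = Q_x({y}); only the values at points of XX matter, here and below *)
Definition is_kernel : Prop :=
  forall x y, x \in XX -> y \in XX -> 0 <= Q x y.

Definition reversible : Prop :=
  forall x y, x \in XX -> y \in XX -> Q x y * mu x = Q y x * mu y.

Definition kernel_supported (rel_ok : rel (cube 'I_n)) : Prop :=
  forall x y, x \in XX -> y \in XX -> Q x y != 0 -> rel_ok x y.

Definition exit_rate_le1 : Prop :=
  forall x, x \in XX -> \sum_(y in XX :\ x) Q x y <= 1.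

(* rho0 = min of max(Q_x(y), Q_y(x)) over x ~ y in XX. If there is no such
   pair the minimum over the empty set is +oo, and every real rho0 is allowed:
   a bound for +oo amounts to the bounds for all rho0. *)
Definition is_min_rate (rho0 : R) : Prop :=
  (forall x y, x \in XX -> y \in XX -> adj x y ->
     rho0 <= Num.max (Q x y) (Q y x)) /\
  ((exists x y, [/\ x \in XX, y \in XX & adj x y]) ->
   exists x y, [/\ x \in XX, y \in XX, adj x y
                 & rho0 = Num.max (Q x y) (Q y x)]).

Definition mean (f : cube 'I_n -> R) : R := \sum_(x in XX) f x * mu x.

Definition Lr_norm (r : R) (f : cube 'I_n -> R) : R :=
  mean (fun x => `|f x| `^ r) `^ (r^-1).

Definition dirichlet (f g : cube 'I_n -> R) : R :=
  2^-1 * \sum_(x in XX) \sum_(y in XX)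
           (f y - f x) * (g y - g x) * Q x y * mu x.

Definition beckner (p alpha : R) : Prop :=
  forall f : cube 'I_n -> R, (forall x, x \in XX -> 0 <= f x) ->
    alpha * (mean (fun x => f x `^ p) - mean f `^ p)
      <= p / 2 * dirichlet f (fun x => f x `^ (p - 1)).

Definition pos_part (t : R) : R := Num.max t 0.
Definition neg_part (t : R) : R := Num.max (- t) 0.

Definition moment_bound (K r : R) : Prop :=
  forall f : cube 'I_n -> R,
    Lr_norm r (fun x => pos_part (f x - mean f))
      <= K * Num.sqrt r *
         Lr_norm r (fun x =>
           Num.sqrt (\sum_(y in XX) neg_part (f y - f x) ^+ 2 * Q x y)).

Definition moment_const (rho0 : R) : R :=
  let sqrt_e := Num.sqrt (expR 1) in
  Num.sqrt (3 * sqrt_e / (rho0 * (sqrt_e - 1))).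

Definition beckner_and_moments (rho0 : R) : Prop :=
  (forall p : R, 1 < p -> p <= 2 ->
     exists2 alpha : R, rho0 / 6 <= alpha & beckner p alpha) /\
  (forall r : R, 2 <= r -> moment_bound (moment_const rho0) r).

End Kernels.

(* Main.v *)
Require Import Defs.
From HB Require Import structures.
From mathcomp Require Import all_boot all_order all_algebra all_fingroup.
From mathcomp Require Import reals sequences exp.
From mathcomp Require Import boolp classical_sets functions.
From mathcomp Require Import topology normedtype derive realfun.
From mathcomp Require Import ring lra.

(* Write gap q a b = (b - a)(b^q - a^q), so that E(f, f^(p-1)) is half the
   integral of gap (p-1) (f x) (f y) against Q_x(y) mu(x). No modified
   log-Sobolev inequality is needed: the Beckner inequality is obtained directly,
   by the recursion of Hermon and Salez. Revealing one coordinate i splits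
   mu(f^p) - mu(f)^p into the same quantity for the two conditional laws plus a
   two-point term, at most P(X_i = 0) P(X_i = 1) gap (p-1) A B, where A and B are
   the two conditional means of f. Since gap q is jointly convex for 0 < q <= 1,
   this is at most the average of the gaps of f along the coupling given by the
   SCP, which only joins adjacent points. Averaging over the order in which the
   coordinates are revealed yields one symmetric flow w(x, y) <= min(mu x, mu y)
   with total rate at most n mu(x), or 2 k mu(x) in the homogeneous case; in (i)
   rho0 w(x, y) <= mu(x) Q_x(y), in (ii) and (iii) Q is w suitably normalised.
   The moment bound applies the Beckner inequality with exponent r / (r - 1) to
   (f - mu f)_+^(r-1), which compares the moments of order r and r - 1. *)

Set Implicit Arguments.
Unset Strict Implicit.
Unset Printing Implicit Defensive.

Import Order.TTheory GRing.Theory Num.Theory.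
Import numFieldNormedType.Exports.
Local Open Scope ring_scope.

(** * Real powers and joint convexity of the gap *)

Section RealPowers.
Local Open Scope classical_set_scope.
Local Open Scope ring_scope.
Variable R : realType.
Implicit Types (a b c d q s t u x y z : R).

(** Bernoulli's inequality. With [m] the right-hand side, [ln x <= x - 1] at [t / m] and at [1 / m],
    weighted by [q] and [1 - q], gives [q * ln t <= ln m]. *)
Lemma powR_le_affine q t : 0 <= q <= 1 -> 0 <= t -> t `^ q <= 1 + q * (t - 1).
Proof.
move=> /andP[q0 q1]; rewrite le_eqVlt => /orP[/eqP <-|t0].
  have [->|qn0] := eqVneq q 0; first by rewrite powRr0 mul0r addr0.
  by rewrite powR0//; lra.
set m := 1 + _; have m0 : 0 < m.
  rewrite /m; have [q'|q'] := ltP q 1; first by have := mulr_ge0 q0 (ltW t0); lra.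
  by rewrite (_ : q = 1); lra.
have ln_le x : 0 < x -> ln x <= x - 1.
  by move=> x0; have := expR_ge1Dx (ln x); rewrite lnK ?posrE//; lra.
have := ln_le _ (divr_gt0 t0 m0); have := ln_le m^-1; rewrite invr_gt0 => /(_ m0).
rewrite lnM ?posrE ?invr_gt0// lnV ?posrE// => h1 h2.
rewrite -(@lnK _ m) ?posrE// /powR gt_eqF// ler_expR.
suff : q * (t / m - 1) + (1 - q) * (m^-1 - 1) = 0.
  have q1' : 0 <= 1 - q by lra.
  by have := ler_wpM2l q1' h1; have := ler_wpM2l q0 h2; lra.
transitivity ((1 + q * (t - 1)) / m - 1); first by field; rewrite gt_eqF.
by rewrite -/m divff ?subrr// gt_eqF.
Qed.

Lemma powR_div x y q : 0 <= x -> 0 <= y -> (x / y) `^ q = x `^ q / y `^ q.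
Proof.
move=> x0 y0; rewrite powRM ?invr_ge0//; congr (_ * _).
by rewrite -(powR_inv1 y0) -powRrM mulN1r powRN.
Qed.

Lemma powR_subr1 u q : 0 < u -> u `^ (q - 1) = u `^ q / u.
Proof. by move=> u0; rewrite powRB ?powRr1 ?(ltW u0)// (gt_eqF u0) implybT. Qed.

Lemma powR_le_tangent q u z : 0 <= q <= 1 -> 0 < u -> 0 <= z ->
  z `^ q <= u `^ q + q * u `^ (q - 1) * (z - u).
Proof.
move=> q01 u0 z0; have := @powR_le_affine q (z / u) q01 (divr_ge0 z0 (ltW u0)).
rewrite powR_div ?(ltW u0)// ler_pdivrMr ?powR_gt0// => h; apply: le_trans h _.
rewrite powR_subr1// le_eqVlt; apply/orP; left.
by apply/eqP; field; rewrite gt_eqF.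
Qed.

(** Bernoulli's inequality with the exponent [1 / s], applied to the [s]-th power of [y / x]. *)
Lemma powR_ge_tangent s x y : 1 <= s -> 0 <= x -> 0 <= y ->
  x `^ s + s * x `^ (s - 1) * (y - x) <= y `^ s.
Proof.
move=> s1 x0 y0; have s0 : 0 < s by lra.
have sV : 0 <= s^-1 <= 1 by rewrite invr_ge0 ltW//= invf_le1.
move: x0; rewrite le_eqVlt => /orP[/eqP <-|x0].
  (* At [x = 0] the slope vanishes except for [s = 1], where zero to the power 0 counts as 1. *)
  rewrite powR0 ?gt_eqF// add0r subr0; have [->|s1'] := eqVneq s 1.
    by rewrite subrr powRr0 !mul1r powRr1.
  by rewrite powR0 ?subr_eq0// mulr0 mul0r powR_ge0.
have := @powR_le_affine s^-1 (y `^ s / x `^ s) sV.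
rewrite divr_ge0 ?powR_ge0// powR_div ?powR_ge0// -!powRrM mulfV ?gt_eqF//.
rewrite !powRr1 ?(ltW x0)// powR_subr1// => /(_ isT).
have xs0 : 0 < x `^ s by exact: powR_gt0.
move: (x `^ s) (y `^ s) xs0 => X Y X0 h.
have -> : X + s * (X / x) * (y - x) = s * X * (y / x) + (1 - s) * X.
  by field; rewrite gt_eqF.
have := ler_wpM2l (ltW (mulr_gt0 s0 X0)) h.
have -> : s * X * (1 + s^-1 * (Y / X - 1)) = s * X + (Y - X).
  by field; rewrite !gt_eqF.
by lra.
Qed.

Definition gap q a b := (b - a) * (b `^ q - a `^ q).

Lemma is_derive_affine a v t : is_derive t 1 (fun t => a + v * t) v.
Proof.
have := is_deriveD (is_derive_cst a t 1) (is_deriveZ v (is_derive_id t 1)).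
by move=> /is_derive_eq; apply; rewrite add0r /GRing.scale/= mulr1.
Qed.

Lemma is_derive_powR_affine q a v t : 0 < a + v * t ->
  is_derive t 1 (fun t => (a + v * t) `^ q) (q * (a + v * t) `^ (q - 1) * v).
Proof.
move=> z0; have dz := is_derive_affine a v t.
have dP := is_derive1_powR q z0.
exact: (@is_derive1_comp R (fun x => x `^ q) (fun t => a + v * t) t _ _ dP dz).
Qed.

(** This is [q] times the excess of v^2 / z^(1-q) over its tangent at [(w, u)]. With Z = z^(1-q), U
    = u^(1-q) and T >= Z the tangent of the concave power at [u], the excess is T (v/T - w/U)^2 +
    v^2 (1/Z - 1/T). *)
Lemma gap_integrand_ge0 q v w z u : 0 < q <= 1 -> 0 < z -> 0 < u ->
  0 <= v * (q * z `^ (q - 1) * v - q * u `^ (q - 1) * w)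
       - q * w * ((q - 1) * u `^ (q - 2) * w * (z - u)
                   + u `^ (q - 1) * (v - w)).
Proof.
move=> /andP[q0 q1] z0 u0.
have th01 : 0 <= 1 - q <= 1 by lra.
have := powR_le_tangent th01 u0 (ltW z0); rewrite powR_subr1//.
have [-> -> ->] : [/\ z `^ (q - 1) = (z `^ (1 - q))^-1,
   u `^ (q - 1) = (u `^ (1 - q))^-1 & u `^ (q - 2) = (u `^ (1 - q))^-1 / u].
  split; rewrite -?powRN ?opprB//.
  by rewrite -powR_subr1//; congr (_ `^ _); lra.
move: (z `^ _) (u `^ _) (powR_gt0 (1 - q) z0) (powR_gt0 (1 - q) u0) => Z U Z0 U0.
set T := U + _ => ZT; have T0 : 0 < T by exact: lt_le_trans ZT.
have : 0 <= q * (T * (v / T - w / U) ^+ 2 + v ^+ 2 * (Z^-1 - T^-1)).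
  apply: mulr_ge0; first exact: ltW.
  by rewrite addr_ge0// mulr_ge0 ?sqr_ge0 ?(ltW T0)// subr_ge0 lef_pV2.
move=> h; apply: (le_trans h); rewrite le_eqVlt; apply/orP; left; apply/eqP.
transitivity (q * (v ^+ 2 / Z - 2 * v * w / U + w ^+ 2 * T / U ^+ 2)).
  by field; rewrite !gt_eqF.
by rewrite /T; field; rewrite !gt_eqF.
Qed.

Lemma affine01_gt0 a b t : 0 < a -> 0 < b -> t \in `[0, 1] ->
  0 < a + (b - a) * t.
Proof.
move=> a0 b0; rewrite in_itv/= => /andP[t0 t1].
have [t12|t12] := ltP t (1 / 2); last by have := mulr_ge0 (ltW b0) t0; nra.
by have := mulr_ge0 (ltW b0) t0; nra.
Qed.

(** The left-hand side is the tangent plane of [gap q] at [(c, d)], regrouped. Since [gap q a b] is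
    the integral of q (b - a)^2 z^(q-1) over the segment z from [a] to [b], the tangent inequality
    for the integrand can be integrated. *)
Lemma gap_ge_tangent q a b c d : 0 < q <= 1 ->
  0 < a -> 0 < b -> 0 < c -> 0 < d ->
  (b - a) * (d `^ q - c `^ q)
  + q * (d - c) * (d `^ (q - 1) * (b - d) - c `^ (q - 1) * (a - c))
  <= gap q a b.
Proof.
move=> q01 a0 b0 c0 d0.
pose z t := a + (b - a) * t; pose u t := c + (d - c) * t.
(* P' is q ((b - a)^2 / z^(1-q) minus the tangent of (v, z) |-> v^2 / z^(1-q)
   at (d - c, u)), which is nonnegative; P 1 - P 0 is the claim. *)
pose P t := (b - a) * (z t `^ q - u t `^ q)
            - q * (d - c) * (u t `^ (q - 1) * (z t - u t)).
pose dP t := (b - a) * (q * z t `^ (q - 1) * (b - a) - q * u t `^ (q - 1) * (d - c))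
  - q * (d - c) * ((q - 1) * u t `^ (q - 2) * (d - c) * (z t - u t)
                   + u t `^ (q - 1) * ((b - a) - (d - c))).
have PE t : t \in `[0, 1] -> is_derive t 1 P (dP t).
  move=> t01; have z0 := affine01_gt0 a0 b0 t01.
  have u0 := affine01_gt0 c0 d0 t01.
  have dzq := is_derive_powR_affine q z0; have duq := is_derive_powR_affine q u0.
  have duq1 := is_derive_powR_affine (q - 1) u0.
  have dzu := is_deriveB (is_derive_affine a (b - a) t) (is_derive_affine c (d - c) t).
  have := is_deriveB (is_deriveZ (b - a) (is_deriveB dzq duq))
    (is_deriveZ (q * (d - c)) (is_deriveM duq1 dzu)).
  move=> h; apply: (is_derive_eq h); rewrite /dP /GRing.scale/= /z /u.
  rewrite (_ : q - 1 - 1 = q - 2); last by lra.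

  by rewrite !fctE/=; ring.
have P0 : P 0 = (b - a) * (a `^ q - c `^ q) - q * (d - c) * (c `^ (q - 1) * (a - c)).
  by rewrite /P /z /u !mulr0 !addr0.
have P1 : P 1 = (b - a) * (b `^ q - d `^ q) - q * (d - c) * (d `^ (q - 1) * (b - d)).
  by rewrite /P /z /u !mulr1 !subrKC.
have dP_ge0 t : t \in `[0, 1] -> 0 <= dP t.
  by move=> t01; apply: gap_integrand_ge0 => //; exact: affine01_gt0.
clearbody P dP.
have dP1 t : t \in `[0, 1] -> derivable P t 1 by move=> /PE h; exact: ex_derive.
have : P 0 <= P 1.
  apply: (@ger0_derive1_ndecr R P 0 1 _ _ _ 0 1) => //.
  - by move=> t /subset_itv_oo_cc /dP1.
  - move=> t /subset_itv_oo_cc t01; have h := PE _ t01.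
    by rewrite derive1E (@derive_val _ _ _ _ _ _ _ h) dP_ge0.
  - exact: derivable_within_continuous.
by rewrite P0 P1 /gap; lra.
Qed.

(** Average the tangent inequality at the barycentre [(c, d)]: the first-order terms cancel. *)
Lemma gap_jensen_gt0 (J : finType) (k f g : J -> R) q : 0 < q <= 1 ->
  (forall j, 0 <= k j) -> \sum_j k j = 1 ->
  (forall j, 0 < f j) -> (forall j, 0 < g j) ->
  gap q (\sum_j k j * f j) (\sum_j k j * g j) <= \sum_j k j * gap q (f j) (g j).
Proof.
move=> q01 k0 k1 f0 g0.
have sum_gt0 h : (forall j, 0 < h j) -> 0 < \sum_j k j * h j.
  move=> h0; rewrite lt0r sumr_ge0 ?andbT; last first.
    by move=> j _; rewrite mulr_ge0// ltW.
  apply/eqP => /psumr_eq0P h_eq0; have := oner_neq0 R; rewrite -k1 big1 ?eqxx// => j _.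
  have /eqP := h_eq0 (fun j _ => mulr_ge0 (k0 j) (ltW (h0 j))) j isT.
  by rewrite mulf_eq0 [h j == 0]gt_eqF// orbF => /eqP.
set c := \sum_j k j * f j; set d := \sum_j k j * g j.
have c0 : 0 < c by exact: sum_gt0.
have d0 : 0 < d by exact: sum_gt0.
apply: le_trans (ler_sum _ (fun j _ => ler_wpM2l (k0 j)
  (gap_ge_tangent q01 (f0 j) (g0 j) c0 d0))).
(* The factors 1 stand for the total weight [\sum_j k j], so that this matches the summed tangent
   planes. *)
have -> : gap q c d = (d - c) * (d `^ q - c `^ q)
    + q * (d - c) * (d `^ (q - 1) * (d - d * 1) - c `^ (q - 1) * (c - c * 1)).
  by rewrite !mulr1 !subrr !mulr0 subrr mulr0 addr0.
rewrite le_eqVlt; apply/orP; left; apply/eqP.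
transitivity (\sum_j ((k j * g j - k j * f j) * (d `^ q - c `^ q)
  + q * (d - c) * (d `^ (q - 1) * (k j * g j - d * k j)
                   - c `^ (q - 1) * (k j * f j - c * k j)))); last first.
  by apply: eq_bigr => j _; ring.
rewrite big_split/= -mulr_suml sumrB -/c -/d; congr (_ + _).
by rewrite -mulr_sumr sumrB -!mulr_sumr !sumrB -!mulr_sumr k1.
Qed.

Lemma powR_cvg_right q x : 0 < q -> 0 <= x ->
  (x + e) `^ q @[e --> 0^'+] --> x `^ q.
Proof.
move=> q0; rewrite le_eqVlt => /orP[/eqP <-|x0].
  rewrite powR0 ?gt_eqF//; under eq_fun do rewrite add0r.
  exact: powR_cvg0.
apply: cvg_at_right_filter.
have cx : {for x, continuous (fun y : R => y `^ q)}.
  apply/differentiable_continuous/derivable1_diffP.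
  by apply: derivable_powR; rewrite in_itv/= x0.
apply: (@cvg_comp _ _ _ (fun e : R => x + e) (fun y : R => y `^ q) _ (nbhs x)).
  have : x + e @[e --> (0 : R)] --> x + 0.
    by apply: cvgD; [exact: cvg_cst | exact: cvg_id].
  by rewrite addr0.
exact: cx.
Qed.

Lemma gap_jensen (J : finType) (k f g : J -> R) q : 0 < q <= 1 ->
  (forall j, 0 <= k j) -> \sum_j k j = 1 ->
  (forall j, 0 <= f j) -> (forall j, 0 <= g j) ->
  gap q (\sum_j k j * f j) (\sum_j k j * g j) <= \sum_j k j * gap q (f j) (g j).
Proof.
move=> q01 k0 k1 f0 g0; have /andP[q0 _] := q01.
have cvg_gap a b : 0 <= a -> 0 <= b ->
    gap q (a + e) (b + e) @[e --> 0^'+] --> gap q a b.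
  move=> a0 b0; rewrite /gap; under eq_fun do rewrite opprD addrACA subrr addr0.
  by apply: cvgM; [exact: cvg_cst | apply: cvgB; exact: powR_cvg_right].
have F0 : 0 <= \sum_j k j * f j by apply: sumr_ge0 => j _; rewrite mulr_ge0.
have G0 : 0 <= \sum_j k j * g j by apply: sumr_ge0 => j _; rewrite mulr_ge0.
rewrite -subr_ge0.
have lhs_cvg := cvg_gap _ _ F0 G0.
have rhs_cvg : \sum_j k j * gap q (f j + e) (g j + e) @[e --> 0^'+] -->
    \sum_j k j * gap q (f j) (g j).
  apply: cvg_big => [|j _]; last by apply: cvgM; [exact: cvg_cst | exact: cvg_gap].
  by apply: add_continuous.
apply: (cvgr_to_ge (cvgB rhs_cvg lhs_cvg)).
near=> e; have e0 : 0 < e by near: e; exact: nbhs_right_gt.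
have shift h : \sum_j k j * h j + e = \sum_j k j * (h j + e).
  by under [in RHS]eq_bigr do rewrite mulrDr; rewrite big_split/= -mulr_suml k1 mul1r.
rewrite subr_ge0 !shift; apply: gap_jensen_gt0 => // j; exact: ltr_wpDl.
Unshelve. all: by end_near. Qed.

End RealPowers.

(** * Pinned laws and the covering coupling *)

Lemma gapC (R : realType) (q a b : R) : gap q a b = gap q b a.
Proof. by rewrite /gap; ring. Qed.

Lemma gap_ge0 (R : realType) (q a b : R) : 0 <= q -> 0 <= a -> 0 <= b ->
  0 <= gap q a b.
Proof.
move=> q0 a0 b0; wlog ab : a b a0 b0 / a <= b.
  by move=> h; case/orP: (le_total a b) => ?; [|rewrite gapC]; exact: h.
by rewrite mulr_ge0 ?subr_ge0// ge0_ler_powR.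
Qed.

Lemma powR_weighted_concave (R : realType) (q s t a b : R) : 0 < q <= 1 ->
  0 < s -> 0 < t -> 0 <= a -> 0 <= b ->
  s * a `^ q + t * b `^ q <= (s + t) * ((s * a + t * b) / (s + t)) `^ q.
Proof.
move=> /andP[q0 q1] s0 t0 a0 b0; set m := _ / _.
have m0 : 0 <= m by rewrite divr_ge0 ?addr_ge0 ?mulr_ge0// ltW.
have mE : (s + t) * m = s * a + t * b by rewrite /m mulrC divfK// gt_eqF ?addr_gt0.
move: m0; rewrite le_eqVlt => /orP[/eqP m0|m0].
  have := mulr_ge0 (ltW s0) a0; have := mulr_ge0 (ltW t0) b0.
  move: mE; rewrite -m0 mulr0 => ab tb sa.
  have /eqP : s * a = 0 by lra.
  have /eqP : t * b = 0 by lra.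
  rewrite !mulf_eq0 !(gt_eqF s0) !(gt_eqF t0)/= => /eqP -> /eqP ->.
  by rewrite powR0 ?gt_eqF// !mulr0 addr0.
have q01 : 0 <= q <= 1 by rewrite q1 ltW.
have := ler_wpM2l (ltW s0) (powR_le_tangent q01 m0 a0).
have := ler_wpM2l (ltW t0) (powR_le_tangent q01 m0 b0).
move: (m `^ q) (q * _) (a `^ q) (b `^ q) mE => u v X Y mE hb ha.
suff : s * (u + v * (a - m)) + t * (u + v * (b - m)) = (s + t) * u by lra.
transitivity ((s + t) * u + v * (s * a + t * b - (s + t) * m)); first by ring.
by rewrite mE subrr mulr0 addr0.
Qed.

(** Write x^p = x * x^(p-1) and bound the (p-1)-st power of the mean from below by the mean of the
    (p-1)-st powers. What remains is a two-point covariance, equal to the right-hand side. *)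
Lemma entropy_two_point (R : realType) (p s t a b : R) : 1 < p -> p <= 2 ->
  0 < s -> 0 < t -> 0 <= a -> 0 <= b ->
  s * a `^ p + t * b `^ p - (s + t) * ((s * a + t * b) / (s + t)) `^ p
  <= s * t / (s + t) * gap (p - 1) a b.
Proof.
move=> p1 p2 s0 t0 a0 b0.
have q01 : 0 < p - 1 <= 1 by lra.
have p0 : 0 < p by lra.
have := powR_weighted_concave q01 s0 t0 a0 b0; set m := _ / _.
have m0 : 0 <= m by rewrite divr_ge0 ?addr_ge0 ?mulr_ge0// ltW.
rewrite -(mulr_powRB1 a0 p0) -(mulr_powRB1 b0 p0) -(mulr_powRB1 m0 p0) /gap.
move: (a `^ _) (b `^ _) (m `^ _) => X Y Z h; have := ler_wpM2l m0 h.
have -> : s * t / (s + t) * ((b - a) * (Y - X))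
    = s * (a * X) + t * (b * Y) - m * (s * X + t * Y).
  by rewrite /m; field; rewrite gt_eqF ?addr_gt0.
by lra.
Qed.

Section Pinning.
Variables (R : realType) (n : nat).
Implicit Types (I : {set 'I_n}) (x y z : cube 'I_n) (mu nu : cube 'I_n -> R).

Definition agree I z x := [forall i in I, x i == z i].

Definition set_coord z i b : cube 'I_n := [ffun j => if j == i then b else z j].

(** Only the coordinates of [z] in [I] matter; a full point avoids dependent types. Without
    normalisation, revealing one more coordinate splits the measure into two summands, and its mass
    is P(X_I = z_I). *)
Definition pinned mu I z x : R := if agree I z x then mu x else 0.

Definition mass nu : R := \sum_x nu x.

Lemma agreeP I z x : reflect {in I, x =1 z} (agree I z x).
Proof.
by apply: (iffP forall_inP) => h i iI; [apply/eqP; exact: h|rewrite h].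
Qed.

Lemma restr_eq I z x : (restr I x == restr I z) = agree I z x.
Proof.
apply/eqP/agreeP => [h i iI|h]; last by apply/ffunP => i; rewrite !ffunE h// (valP i).
by have /ffunP/(_ (exist _ i iI)) := h; rewrite !ffunE.
Qed.

Lemma agree_set_coord I z i b x : i \notin I ->
  agree (i |: I) (set_coord z i b) x = agree I z x && (x i == b).
Proof.
move=> iI; apply/agreeP/andP => [h|[/agreeP h /eqP xi] j].
  split; last by rewrite h ?setU11// ffunE eqxx.
  apply/agreeP => j jI; rewrite h ?inE ?jI ?orbT// ffunE.
  by case: eqP iI => // <-; rewrite jI.
by rewrite !inE ffunE; case: eqP => [-> _|_ /=]; [exact: xi|exact: h].
Qed.

Lemma pinned_set_coord mu I z i b x : i \notin I ->
  pinned mu (i |: I) (set_coord z i b) x = if x i == b then pinned mu I z x else 0.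
Proof.
by move=> iI; rewrite /pinned agree_set_coord// andbC; case: (x i == b).
Qed.

Lemma marginal_restr mu I z : marginal mu (restr I z) = mass (pinned mu I z).
Proof.
rewrite /marginal /mass big_mkcond/=; apply: eq_bigr => x _.
by rewrite restr_eq.
Qed.

Lemma cond_law_restr mu I z x : agree I z x ->
  cond_law mu (restr I z) (restr (~: I) x) = mu x / mass (pinned mu I z).
Proof.
move=> xz; rewrite /cond_law marginal_restr; congr (_ / _).
rewrite (big_pred1 x)// => y; rewrite !restr_eq.
apply/andP/eqP => [[/agreeP yz /agreeP yx]|->]; last by split => //; apply/agreeP.
apply/ffunP => i; have [iI|iI] := boolP (i \in I).
  by rewrite yz//; move/agreeP: xz => ->.
by rewrite yx// inE.
Qed.

(** Inverse of [restr (~: I)] on the points that agree with [z] on [I]; [insub] tests whether [j]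
    lies outside [I]. *)
Definition glue I z (v : cube (coords (~: I))) : cube 'I_n :=
  [ffun j => if @insub _ _ (coords (~: I)) j is Some j' then v j' else z j].

Lemma restr_glue I z (v : cube (coords (~: I))) : restr (~: I) (glue z v) = v.
Proof. by apply/ffunP => j; rewrite !ffunE valK. Qed.

Lemma agree_glue I z (v : cube (coords (~: I))) : agree I z (glue z v).
Proof.
apply/agreeP => j jI; rewrite ffunE insubF//.
by rewrite inE jI.
Qed.

Lemma glueK I z x : agree I z x -> glue z (restr (~: I) x) = x.
Proof.
move=> /agreeP xz; apply/ffunP => j; rewrite ffunE.
by case: insubP => [j' _ <-|]; [rewrite ffunE | rewrite inE negbK => /xz].
Qed.

Lemma sum_restr I z (F : cube (coords (~: I)) -> R) :
  \sum_(x | agree I z x) F (restr (~: I) x) = \sum_v F v.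
Proof.
rewrite (reindex_onto (@glue I z) (restr (~: I))); last by move=> x; exact: glueK.
by apply: eq_big => [v|v _]; rewrite ?agree_glue restr_glue ?eqxx.
Qed.

(** Here [x i] is 0 and [y i] is 1. If [x] and [y] agree on the unrevealed coordinates, they differ
    by a flip at [i]; if [x] has one extra 1 there, at [l], they differ by the transposition of [i]
    and [l]. *)
Lemma covers_adj I z i x y : i \notin I ->
  agree (i |: I) (set_coord z i false) x -> agree (i |: I) (set_coord z i true) y ->
  covers (restr (~: (i |: I)) x) (restr (~: (i |: I)) y) -> adj x y.
Proof.
move=> iI; rewrite !agree_set_coord// =>
  /andP[/agreeP xz /eqP xi] /andP[/agreeP yz /eqP yi].
have off j (jK : j \in ~: (i |: I)) (w : cube _) : w j = restr (~: (i |: I)) w (exist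
  _ j jK).
  by rewrite ffunE.
have on j : j \notin ~: (i |: I) -> j != i -> x j = y j.
  by rewrite !inE negbK => /orP[/eqP ->|jI _]; rewrite ?eqxx// xz// yz.
case/orP => [/eqP xy|/existsP[[l lK] /forallP xy]]; rewrite /adj.
  apply/orP; left; apply/existsP; exists i; apply/forallP => j; apply/eqP.
  have [->|ji] := eqVneq j i; first by rewrite xi yi.
  have [jK|jK] := boolP (j \in ~: (i |: I)); last by rewrite on ?eqxx.
  by rewrite !(off _ jK) xy eqxx.
have li : l != i by apply: contraTneq (lK) => ->; rewrite !inE eqxx.
have [xl yl] : x l = true /\ y l = false.
  have := xy (exist _ l lK); rewrite !ffunE eqxx/=.
  by case: (x l) (y l) => [] [].
apply/orP; right; apply/andP; split.
  by apply/eqP => xy0; move: xi; rewrite xy0 yi.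
apply/existsP; exists i; apply/existsP; exists l; apply/eqP/ffunP => j.
rewrite ffunE; case: tpermP => [->|->|/eqP ji /eqP jl]; rewrite ?xl ?yl ?xi ?yi//.
have [jK|jK] := boolP (j \in ~: (i |: I)); last by rewrite on.
have := xy (exist _ j jK); rewrite !ffunE -val_eqE/= (negPf jl) addn0.
by case: (x j) (y j) => [] [].
Qed.

(** The pinning with [true] at [i] covers the one with [false], so by the SCP the law given X_i = 0
    covers the law given X_i = 1; [covers_adj] turns covering into adjacency. *)
Lemma SCP_coupling mu I z i : SCP mu -> i \notin I ->
  let nu b := pinned mu (i |: I) (set_coord z i b) in
  0 < mass (nu false) -> 0 < mass (nu true) ->
  exists kappa : cube 'I_n -> cube 'I_n -> R,
    [/\ forall x y, 0 <= kappa x y,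
        forall x, \sum_y kappa x y = nu false x / mass (nu false),
        forall y, \sum_x kappa x y = nu true y / mass (nu true)
      & forall x y, kappa x y != 0 -> [/\ adj x y, x i = false & y i = true]].
Proof.
move=> scp iI nu M0 M1; pose K := i |: I.
pose ag b := agree K (set_coord z i b).
have cov : covers (restr K (set_coord z i true)) (restr K (set_coord z i false)).
  apply/orP; right; apply/existsP; exists (exist _ i (setU11 _ _)).
  apply/forallP => j; rewrite !ffunE (_ : (j == exist _ i _) = (val j == i))//.
  by case: (val j =P i) => _ //=; rewrite addn0.
have [||pi [pi0 piL piR pi_cov]] := scp K _ _ _ _ cov; rewrite ?marginal_restr//.
(* The coupling of the unrevealed coordinates, carried to the whole cube and extended by zero. *)
exists (fun x y => if ag false x && ag true y
                   then pi (restr (~: K) x) (restr (~: K) y) else 0); split.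
- by move=> x y; case: ifP.
- move=> x; rewrite /nu /pinned -/(ag false); case: ifP => [xz|_] /=; last first.
    by rewrite mul0r big1.
  by rewrite -big_mkcond sum_restr piL cond_law_restr.
- move=> y; rewrite /nu /pinned -/(ag true); case: ifP => [yz|_] /=; last first.
    by rewrite mul0r big1// => x _; rewrite andbF.
  under eq_bigr do rewrite andbT.
  by rewrite -big_mkcond (@sum_restr _ _ (fun u => pi u _)) piR cond_law_restr.
- move=> x y; case: ifP => [/andP[xz yz] /pi_cov h|_]; last by rewrite eqxx.
  split; first exact: covers_adj xz yz h.
    by move: xz; rewrite /ag agree_set_coord// => /andP[_ /eqP].
  by move: yz; rewrite /ag agree_set_coord// => /andP[_ /eqP].
Qed.

End Pinning.

(** * Entropy, energy and the flow created by revealing one coordinate *)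

Section Flows.
Variables (R : realType) (n : nat).
Implicit Types (p : R) (I : {set 'I_n}) (x y z : cube 'I_n).
Implicit Types (mu nu f : cube 'I_n -> R) (w : cube 'I_n -> cube 'I_n -> R).

(** For an unnormalised [nu]: the mass times mu(f^p) - mu(f)^p for the normalised law mu, so that
    the entropies of the slices can be subtracted directly. *)
Definition entropy p nu f : R :=
  \sum_x f x `^ p * nu x - mass nu * ((\sum_x f x * nu x) / mass nu) `^ p.

Definition energy p w f : R :=
  2^-1 * \sum_x \sum_y gap (p - 1) (f x) (f y) * w x y.

(** [w x y] plays the role of Q_x(y) mu(x). Symmetry and [flow_le] together give
    [w x y <= min (nu x) (nu y)], and a single [w] serves all exponents [p]. *)
Record flow nu w : Prop := Flow {
  flow_ge0 : forall x y, 0 <= w x y;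
  flow_sym : forall x y, w x y = w y x;
  flow_adj : forall x y, w x y != 0 -> adj x y;
  flow_le : forall x y, w x y <= nu x;
  flow_entropy : forall p f, 1 < p -> p <= 2 -> (forall x, 0 <= f x) ->
    entropy p nu f <= energy p w f }.

Lemma mass_eq0 nu : (forall x, 0 <= nu x) -> mass nu = 0 -> forall x, nu x = 0.
Proof. by move=> nu0 /psumr_eq0P h x; apply: h. Qed.

Lemma energy0 p f : energy p (fun _ _ => 0) f = 0.
Proof.
rewrite /energy big1 ?mulr0// => x _; rewrite big1// => y _; exact: mulr0.
Qed.

Lemma energyD p w1 w2 f :
  energy p (fun x y => w1 x y + w2 x y) f = energy p w1 f + energy p w2 f.
Proof.
rewrite /energy -mulrDr -big_split/=; congr (_ * _); apply: eq_bigr => x _.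
by rewrite -big_split/=; apply: eq_bigr => y _; rewrite mulrDr.
Qed.

Lemma energyZ p c w f : energy p (fun x y => c * w x y) f = c * energy p w f.
Proof.
rewrite /energy mulrCA; congr (_ * _); rewrite mulr_sumr; apply: eq_bigr => x _.
by rewrite mulr_sumr; apply: eq_bigr => y _; rewrite mulrCA.
Qed.

Lemma energy_sum (J : finType) (P : pred J) p (w : J -> cube 'I_n -> cube 'I_n -> R) f :
  energy p (fun x y => \sum_(j | P j) w j x y) f = \sum_(j | P j) energy p (w j) f.
Proof.
rewrite /energy -mulr_sumr; congr (_ * _).
rewrite [RHS]exchange_big/=; apply: eq_bigr => x _.
by rewrite [RHS]exchange_big/=; apply: eq_bigr => y _; rewrite mulr_sumr.
Qed.

Lemma energyT p w f : energy p (fun x y => w y x) f = energy p w f.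
Proof.
rewrite /energy exchange_big/=; congr (_ * _); apply: eq_bigr => x _.
by apply: eq_bigr => y _; rewrite gapC.
Qed.

Section Cross.
Variables (nu : cube 'I_n -> R) (i : 'I_n).
Hypothesis nu_ge0 : forall x, 0 <= nu x.

Definition slice b x : R := if x i == b then nu x else 0.

Lemma slice_ge0 b x : 0 <= slice b x.
Proof. by rewrite /slice; case: ifP. Qed.

Lemma sliceD x : slice false x + slice true x = nu x.
Proof. by rewrite /slice; case: (x i); rewrite ?addr0 ?add0r. Qed.

Lemma slice_le b x : slice b x <= nu x.
Proof. by rewrite /slice; case: ifP. Qed.

Lemma mass_sliceD : mass (slice false) + mass (slice true) = mass nu.
Proof. by rewrite /mass -big_split/=; apply: eq_bigr => x _; exact: sliceD. Qed.

Lemma sum_sliceD f :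
  \sum_x f x * slice false x + \sum_x f x * slice true x = \sum_x f x * nu x.
Proof. by rewrite -big_split/=; apply: eq_bigr => x _; rewrite -mulrDr sliceD. Qed.

(* The premise is what SCP_coupling provides; the flow is the coupling, made
   symmetric, times P(X_i = 0) P(X_i = 1). *)
Lemma cross_flow :
  (0 < mass (slice false) -> 0 < mass (slice true) ->
   exists kappa : cube 'I_n -> cube 'I_n -> R,
    [/\ forall x y, 0 <= kappa x y,
        forall x, \sum_y kappa x y = slice false x / mass (slice false),
        forall y, \sum_x kappa x y = slice true y / mass (slice true)
      & forall x y, kappa x y != 0 -> [/\ adj x y, x i = false & y i = true]]) ->
  exists c : cube 'I_n -> cube 'I_n -> R,
  [/\ [/\ forall x y, 0 <= c x y, forall x y, c x y = c y x &
          forall x y, c x y != 0 -> adj x y /\ x i != y i],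
      forall x, \sum_y c x y <= (mass (slice (~~ x i)) / mass nu) * nu x
    & forall p f, 1 < p -> p <= 2 -> (forall x, 0 <= f x) ->
      entropy p nu f - entropy p (slice false) f - entropy p (slice true) f
      <= energy p c f].
Proof.
have massh0 b : 0 <= mass (slice b) by apply: sumr_ge0 => x _; exact: slice_ge0.
have mass0 : 0 <= mass nu by apply: sumr_ge0.
(* If one value of X_i has mass 0, [nu] is the other slice, revealing [i] costs no entropy, and the
   zero flow suffices. *)
have degenerate b : mass (slice b) = 0 -> exists c : cube 'I_n -> cube 'I_n -> R,
  [/\ [/\ forall x y, 0 <= c x y, forall x y, c x y = c y x &
          forall x y, c x y != 0 -> adj x y /\ x i != y i],
      forall x, \sum_y c x y <= (mass (slice (~~ x i)) / mass nu) * nu x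
    & forall p f, 1 < p -> p <= 2 -> (forall x, 0 <= f x) ->
      entropy p nu f - entropy p (slice false) f - entropy p (slice true) f
      <= energy p c f].
  move=> Mb; have hb := mass_eq0 (slice_ge0 b) Mb.
  have nuE : nu = slice (~~ b).
    by apply/funext => x; rewrite -sliceD; case: b hb {Mb} => hb;
      rewrite hb ?addr0 ?add0r.
  exists (fun _ _ => 0); split; first by split => // x y; rewrite eqxx.
    by move=> x; rewrite big1// mulr_ge0// divr_ge0.
  move=> p f p1 p2 f0; rewrite energy0.
  have eb : entropy p (slice b) f = 0.
    rewrite /entropy Mb mul0r subr0 big1// => x _; by rewrite hb mulr0.
  by rewrite {1}nuE; case: b eb {Mb hb nuE} => ->;
    rewrite ?subr0 ?subrr// addrAC subrr subr0.
have [/eqP M0|M0] := boolP (mass (slice false) == 0); first by move=> _;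
  exact: degenerate M0.
have [/eqP M1|M1] := boolP (mass (slice true) == 0); first by move=> _;
  exact: degenerate M1.
have {}M0 : 0 < mass (slice false) by rewrite lt0r M0 massh0.
have {}M1 : 0 < mass (slice true) by rewrite lt0r M1 massh0.
move=> /(_ M0 M1)[kappa [k0 kL kR kadj]].
set m0 := mass (slice false) in M0 kL *; set m1 := mass (slice true) in M1 kR *.
have ME : mass nu = m0 + m1 by rewrite -mass_sliceD.
(* This is [mass nu] times P(X_i = 0) P(X_i = 1), the weight of the gap in [entropy_two_point]. *)
pose r := m0 * m1 / (m0 + m1).
have r0 : 0 < r by rewrite divr_gt0 ?mulr_gt0 ?addr_gt0.
have kN x y : x i || ~~ y i -> kappa x y = 0.
  by move=> xy; apply/eqP; apply: contraTT xy => /kadj[_ -> ->].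
exists (fun x y => r * (kappa x y + kappa y x)); split.
- split; [by move=> x y; rewrite mulr_ge0 ?addr_ge0 ?(ltW r0)|by move=> x y;
  rewrite addrC|].
  move=> x y; rewrite mulf_eq0 negb_or => /andP[_].
  have [-> |/kadj[xy -> ->]//] := eqVneq (kappa x y) 0;
    rewrite add0r => /kadj[yx -> ->].
  split => //; move: yx; rewrite /adj => /orP[/existsP[j /forallP h]|].
    by apply/orP; left; apply/existsP; exists j; apply/forallP => l;
      rewrite [x l == _]eq_sym; exact: h.
  move=> /andP[yx /existsP[j /existsP[l /eqP xE]]]; apply/orP; right.
  rewrite /differ_transp eq_sym yx; apply/existsP; exists j; apply/existsP; exists l.
  by apply/eqP/ffunP => t; rewrite ffunE xE ffunE tpermK.
(* Only one of the two marginals of [kappa] charges [x]; dividing [r] by the mass of its slice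
   leaves the probability of the opposite value of X_i. *)
- move=> x; rewrite -mulr_sumr big_split/= kL kR ME {1 2}/slice; case: (x i) => /=.
    by rewrite -/m0 mul0r add0r le_eqVlt; apply/orP; left; apply/eqP; rewrite /r;
      field; rewrite !gt_eqF ?addr_gt0.
  by rewrite -/m1 mul0r addr0 le_eqVlt; apply/orP; left; apply/eqP; rewrite /r;
    field; rewrite !gt_eqF ?addr_gt0.
move=> p f p1 p2 f0.
rewrite energyZ energyD (energyT _ kappa).
have -> : energy p kappa f + energy p kappa f
    = \sum_(xy : cube 'I_n * cube 'I_n) kappa xy.1 xy.2 * gap (p - 1) (f xy.1) (f xy.2).
  rewrite /energy -mulrDl (_ : 2^-1 + 2^-1 = 1) ?mul1r ?pair_big/=; last by field.
  by apply: eq_bigr => xy _; rewrite mulrC.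
have q01 : 0 < p - 1 <= 1 by lra.
have FL : \sum_(xy : cube 'I_n * cube 'I_n) kappa xy.1 xy.2 * f xy.1
    = (\sum_x f x * slice false x) / m0.
  rewrite -(pair_bigA _ (fun x y => kappa x y * f x))/= mulr_suml.
  by apply: eq_bigr => x _; rewrite -mulr_suml kL mulrC mulrA.
have FR : \sum_(xy : cube 'I_n * cube 'I_n) kappa xy.1 xy.2 * f xy.2
    = (\sum_x f x * slice true x) / m1.
  rewrite -(pair_bigA _ (fun x y => kappa x y * f y))/= exchange_big/= mulr_suml.
  by apply: eq_bigr => x _; rewrite -mulr_suml kR mulrC mulrA.
have k1 : \sum_(xy : cube 'I_n * cube 'I_n) kappa xy.1 xy.2 = 1.
  rewrite -(pair_bigA _ (fun x y => kappa x y))/=.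
  by under eq_bigr do rewrite kL; rewrite -mulr_suml divff// gt_eqF.
(* Jensen along the coupling: the gap of the two conditional means is at most the average gap of [f]
   under [kappa]. *)
have := @gap_jensen R _ (fun xy : cube 'I_n * cube 'I_n => kappa xy.1 xy.2)
  (fun xy => f xy.1) (fun xy => f xy.2) (p - 1) q01 (fun _ => k0 _ _) k1
  (fun _ => f0 _) (fun _ => f0 _).
rewrite FL FR => /(ler_wpM2l (ltW r0)); apply: le_trans.
set F0 := \sum_x f x * slice false x; set F1 := \sum_x f x * slice true x.
have F0_ge0 b : 0 <= \sum_x f x * slice b x.
  by apply: sumr_ge0 => x _; rewrite mulr_ge0 ?slice_ge0.
have := entropy_two_point p1 p2 M0 M1 (divr_ge0 (F0_ge0 false) (ltW M0))
  (divr_ge0 (F0_ge0 true) (ltW M1)).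
rewrite -/r -/F0 -/F1 ![_ * (_ / _)]mulrC !divfK ?(gt_eqF M0) ?(gt_eqF M1)//.
apply: le_trans; rewrite /entropy -sum_sliceD -(sum_sliceD f) ME -/F0 -/F1 -/m0 -/m1.
by rewrite le_eqVlt; apply/orP; left; apply/eqP; ring.
Qed.

End Cross.

End Flows.

(** * The flow of an SCP law *)

Section FlowExistence.
Variables (R : realType) (n : nat).
Implicit Types (p : R) (I : {set 'I_n}) (x y z : cube 'I_n).
Implicit Types (mu nu f : cube 'I_n -> R) (w : cube 'I_n -> cube 'I_n -> R).

Lemma slice_pinned mu I z i b : i \notin I ->
  slice (pinned mu I z) i b = pinned mu (i |: I) (set_coord z i b).
Proof. by move=> iI; apply/funext => x; rewrite pinned_set_coord. Qed.

Lemma pinned_ge0 mu I z : (forall x, 0 <= mu x) -> forall x, 0 <= pinned mu I z x.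
Proof. by move=> mu0 x; rewrite /pinned; case: ifP. Qed.

Lemma flow_outside nu w x y : (forall x, 0 <= nu x) -> flow nu w -> nu x = 0 -> w x y
  = 0.
Proof.
move=> nu0 fl nx; apply/eqP; rewrite eq_le (flow_ge0 fl) andbT -nx.
exact: flow_le fl x y.
Qed.

Lemma le_sum1 (J : finType) (F : J -> R) j : (forall j, 0 <= F j) -> F j <= \sum_j F j.
Proof. by move=> F0; rewrite (bigD1 j)//= lerDl sumr_ge0. Qed.

(** Add the flows of both slices and the cross flow. Their supports are disjoint: [w0] needs [x i]
    and [y i] both 0, [w1] both 1, and the cross flow needs them distinct. Hence the pointwise bound
    by [nu x] survives the addition. *)
Lemma flow_step mu I z i w0 w1 : (forall x, 0 <= mu x) -> SCP mu -> i \notin I ->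
  let nu := pinned mu I z in
  flow (slice nu i false) w0 -> flow (slice nu i true) w1 ->
  exists2 w, flow nu w & forall x, \sum_y w x y <=
    \sum_y w0 x y + \sum_y w1 x y + mass (slice nu i (~~ x i)) / mass nu * nu x.
Proof.
move=> mu0 scp iI nu fl0 fl1.
have nu0 : forall x, 0 <= nu x by exact: pinned_ge0.
have h0 b : forall x, 0 <= slice nu i b x by exact: slice_ge0.
have [|c [[c0 cC cadj] crate cent]] := @cross_flow R n nu i nu0.
  by rewrite /nu !slice_pinned//; exact: SCP_coupling.
have c_le x y : c x y <= nu x.
  apply: le_trans (le_sum1 _ (c0 x)) _; apply: (le_trans (crate x)).
  rewrite ler_piMl//; have [->|M0] := eqVneq (mass nu) 0; first by rewrite invr0 mulr0.
  have M : 0 < mass nu by rewrite lt0r M0 sumr_ge0.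
  rewrite ler_pdivrMr// mul1r; apply: ler_sum => y' _; exact: slice_le.
have w0N x y : x i || y i -> w0 x y = 0.
  case/orP => xi; first by apply: (flow_outside _ (h0 false) fl0); rewrite /slice xi.
  by rewrite (flow_sym fl0); apply: (flow_outside _ (h0 false) fl0); rewrite /slice xi.
have w1N x y : ~~ x i || ~~ y i -> w1 x y = 0.
  case/orP => /negPf xi; first by apply: (flow_outside _ (h0 true) fl1);
    rewrite /slice xi.
  by rewrite (flow_sym fl1); apply: (flow_outside _ (h0 true) fl1); rewrite /slice xi.
exists (fun x y => w0 x y + w1 x y + c x y); last first.
  by move=> x; rewrite !big_split/= lerD2l.
split.
- by move=> x y; rewrite !addr_ge0 ?(flow_ge0 fl0) ?(flow_ge0 fl1).
- by move=> x y; rewrite (flow_sym fl0) (flow_sym fl1) cC.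
- move=> x y; have [w0xy|/(flow_adj fl0)//] := eqVneq (w0 x y) 0.
  have [w1xy|/(flow_adj fl1)//] := eqVneq (w1 x y) 0.
  by rewrite w0xy w1xy !add0r => /cadj[].
- move=> x y; have [xy|xy] := boolP (x i == y i); last first.
    rewrite w0N ?w1N ?add0r; first exact: c_le.
      by move: xy; case: (x i) (y i) => [] [].
    by move: xy; case: (x i) (y i) => [] [].
  have -> : c x y = 0 by apply/eqP; apply: contraTT xy => /cadj[].
  rewrite addr0; have [xi|xi] := boolP (x i).
    rewrite w0N ?xi// add0r; apply: le_trans (flow_le fl1 x y) _; exact: slice_le.
  rewrite w1N ?xi// addr0; apply: le_trans (flow_le fl0 x y) _; exact: slice_le.
- move=> p f p1 p2 f0; rewrite !energyD.
  have := cent p f p1 p2 f0; have := flow_entropy fl0 p1 p2 f0.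
  by have := flow_entropy fl1 p1 p2 f0; lra.
Qed.

Lemma entropyZ_energy p nu f (m : R) w : 0 < m ->
  m * entropy p nu f <= energy p w f ->
  entropy p nu f <= energy p (fun x y => m^-1 * w x y) f.
Proof. by move=> m0 h; rewrite energyZ -ler_pdivrMl ?invr_gt0// invrK. Qed.

(* The flow is averaged over the coordinate revealed next: in the homogeneous
   case, it is the average over i of the cross rate at i that is at most
   2 k / #|~: I|. *)
Lemma flow_exists mu m I z : (forall x, 0 <= mu x) -> SCP mu -> #|~: I| = m ->
  let nu := pinned mu I z in
  exists w, [/\ flow nu w, forall x, \sum_y w x y <= m%:R * nu x
    & forall k, (forall x, nu x != 0 -> (\sum_(j in ~: I) x j)%N = k) ->
      forall x, \sum_y w x y <= 2 * k%:R * nu x].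
Proof.
move=> mu0 scp; elim: m I z => [|m IHm] I z cardI nu.
  (* With everything revealed, [nu] is concentrated at [z], its entropy is 0, and the zero flow
     suffices. *)
  have nu0 : forall x, 0 <= nu x by exact: pinned_ge0.
  have nuE x : x != z -> nu x = 0.
    rewrite /nu /pinned; case: ifP => // /agreeP xz /eqP []; apply/ffunP => j.
    by apply: xz; move/eqP: cardI; rewrite cards_eq0 => /eqP/setP/(_ j);
      rewrite !inE => /negbFE.
  have sum_z (F : cube 'I_n -> R) : \sum_x F x * nu x = F z * nu z.
    by rewrite (bigD1 z)//= big1 ?addr0// => x xz; rewrite nuE ?mulr0.
  exists (fun _ _ => 0); split; last first.
  - by move=> k _ x; rewrite big1// !mulr_ge0.
  - by move=> x; rewrite big1// mul0r.
  split => //; first by move=> x y; rewrite eqxx.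
  move=> p f p1 p2 f0; rewrite energy0 /entropy !sum_z.
  have -> : mass nu = nu z.
    by rewrite /mass; under eq_bigr do rewrite -[nu _]mul1r;
      rewrite (sum_z (fun=> 1)) mul1r.
  have [->|nz] := eqVneq (nu z) 0; first by rewrite !mulr0 !mul0r subrr.
  by rewrite mulfK// [X in X - _]mulrC subrr.
have nu0 : forall x, 0 <= nu x by exact: pinned_ge0.
(* The condition on [i] sits under the existential so that [choice] applies. In the last bound,
   [x i = 0] gives 2k from the slice and P(X_i = 1) from the cross flow; [x i = 1] leaves k - 1
   ones, hence 2(k - 1) + P(X_i = 0), which is at most 2k - 1 + P(X_i = 1). *)
have step i : exists w, i \notin I -> [/\ flow nu w,
    forall x, \sum_y w x y <= m.+1%:R * nu x
  & forall k, (forall x, nu x != 0 -> (\sum_(j in ~: I) x j)%N = k) ->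
      forall x, \sum_y w x y <=
        (2 * k%:R - (x i)%:R + mass (slice nu i true) / mass nu) * nu x].
  have [iI|iI] := boolP (i \in I); first by exists (fun _ _ => 0).
  have cardK : #|~: (i |: I)| = m.
    have := cardsD1 i (~: I); rewrite cardI inE iI /= => -[->].
    by congr #|pred_of_set _|; apply/setP => j; rewrite !inE negb_or.
  have [w0 [fl0 rate0 hom0]] := IHm _ (set_coord z i false) cardK.
  have [w1 [fl1 rate1 hom1]] := IHm _ (set_coord z i true) cardK.
  rewrite -!slice_pinned// -/nu in fl0 rate0 hom0 fl1 rate1 hom1.
  have [w fl rate] := flow_step mu0 scp iI fl0 fl1.
  rewrite -/nu in rate; exists w => _; split => // [x|k homk x].
    apply: le_trans (rate x) _; have := rate0 x; have := rate1 x.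
    have := sliceD nu i x; set q := mass _ / _.
    have q1 : q * nu x <= nu x.
      rewrite ler_piMl// /q; have [->|M0] := eqVneq (mass nu) 0;
        first by rewrite invr0 mulr0.
      rewrite ler_pdivrMr ?lt0r ?M0 ?sumr_ge0// mul1r.
      by apply: ler_sum => y' _; exact: slice_le.
    by move=> hE h1 h2; rewrite -hE in q1; rewrite -hE -natr1; lra.
  have [nx|nx] := eqVneq (nu x) 0.
    by rewrite nx mulr0 big1// => y _; apply: flow_outside nx.
  have M : 0 < mass nu by rewrite (lt_le_trans _ (le_sum1 x nu0))// lt0r nx nu0.
  have sumK y : (\sum_(j in ~: I) y j = y i + \sum_(j in ~: (i |: I)) y j)%N.
    rewrite (bigD1 i) ?inE//=; congr (_ + _)%N; apply: eq_bigl => j.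
    by rewrite !inE negb_or andbC.
  apply: le_trans (rate x) _.
  have slice_x b : slice nu i b x = if x i == b then nu x else 0 by [].
  have {}hom0 : \sum_y w0 x y <= 2 * k%:R * slice nu i false x.
    apply: hom0 => y; rewrite /slice; case: (y i =P _) => [yi ny|_];
      last by rewrite eqxx.
    by rewrite -(homk y ny) sumK yi.
  have {}hom1 : \sum_y w1 x y <= 2 * k.-1%:R * slice nu i true x.
    apply: hom1 => y; rewrite /slice; case: (y i =P _) => [yi ny|_];
      last by rewrite eqxx.
    by rewrite -(homk y ny) sumK yi.
  have Mh := mass_sliceD nu i.
  have := sliceD nu i x; move: hom0 hom1; rewrite !slice_x.
  case xi : (x i) => /=; rewrite mulr0 => hom0 hom1 _; last by lra.
  have k1 : (0 < k)%N by rewrite -(homk x nx) sumK xi.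
  rewrite -(prednK k1) -[in 2 * _]natr1.
  have : mass (slice nu i false) / mass nu + mass (slice nu i true) / mass nu = 1.
    by rewrite -mulrDl Mh divff// gt_eqF.
  have t0 : 0 <= mass (slice nu i true) / mass nu * nu x.
    by rewrite mulr_ge0// divr_ge0 ?(ltW M)// sumr_ge0// => y _; exact: slice_ge0.
  move: (mass _ / _) (mass (slice nu i true) / _) t0 hom0 hom1 => q0 q1 t0 hom0 hom1 qq.
  have -> : q0 = 1 - q1 by lra.
  by have := nu0 x; nra.
have [w wP] := choice step.
have m0 : 0 < m.+1%:R :> R by rewrite ltr0n.
have wP' i (iI : i \in ~: I) := wP i (etrans (esym (finset.in_setC i I)) iI).
have card_sum (a : R) : \sum_(i in ~: I) a = m.+1%:R * a.
  by rewrite sumr_const cardI mulr_natl.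
exists (fun x y => m.+1%:R^-1 * \sum_(i in ~: I) w i x y); split.
- split.
  + move=> x y; rewrite mulr_ge0 ?invr_ge0 ?(ltW m0)// sumr_ge0// => i /wP'[fl _ _].
    exact: flow_ge0 fl x y.
  + move=> x y; congr (_ * _); apply: eq_bigr => i /wP'[fl _ _]; exact: flow_sym fl x y.
  + move=> x y; apply: contraNT => xy; rewrite big1 ?mulr0// => i /wP'[fl _ _].
    by apply/eqP; apply: contraNT xy; exact: flow_adj fl x y.
  + move=> x y; rewrite ler_pdivrMl// -card_sum; apply: ler_sum => i /wP'[fl _ _].
    exact: flow_le fl x y.
  + move=> p f p1 p2 f0; apply: entropyZ_energy => //; rewrite -card_sum energy_sum.
    by apply: ler_sum => i /wP'[fl _ _]; exact: flow_entropy fl p f p1 p2 f0.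
- move=> x; rewrite -mulr_sumr exchange_big/= ler_pdivrMl// -(card_sum (_ * nu x)).
  by apply: ler_sum => i /wP'[_ h _]; exact: h.
move=> k homk x; rewrite -mulr_sumr exchange_big/= ler_pdivrMl//.
have [nx|nx] := eqVneq (nu x) 0.
  rewrite nx !mulr0 big1// => i /wP'[fl _ _]; rewrite big1// => y _.
  exact: flow_outside nx.
have M : 0 < mass nu by rewrite (lt_le_trans _ (le_sum1 x nu0))// lt0r nx nu0.
have natr_sum_bool y : nu y != 0 -> \sum_(i in ~: I) (y i)%:R = k%:R :> R.
  by move=> ny; rewrite -(homk y ny) natr_sum.
have mass_sum : \sum_(i in ~: I) mass (slice nu i true) = k%:R * mass nu.
  rewrite /mass exchange_big/= mulr_sumr; apply: eq_bigr => y _.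
  have [ny|ny] := eqVneq (nu y) 0.
    by rewrite ny mulr0 big1// => i _; rewrite /slice ny if_same.
  rewrite -(natr_sum_bool y ny) mulr_suml; apply: eq_bigr => i _.
  by rewrite /slice; case: (y i); rewrite ?mul1r ?mul0r.
(* Summed over [i], the terms - x_i give -k and the terms P(X_i = 1) give +k, so they cancel and the
   average is 2k. *)
apply: (@le_trans _ _ (\sum_(i in ~: I)
  (2 * k%:R - (x i)%:R + mass (slice nu i true) / mass nu) * nu x)).
  by apply: ler_sum => i /wP'[_ _ h]; exact: h.
rewrite -mulr_suml big_split/= sumrB card_sum (natr_sum_bool x nx) -mulr_suml mass_sum.
rewrite mulfK ?gt_eqF// [X in X <= _](_ : _ = m.+1%:R * (2 * k%:R * nu x))//; ring.
Qed.

End FlowExistence.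

(** * Moments *)

Lemma young_scaled (R : realType) (r s a b x y : R) : 0 < r -> 0 < s ->
  r^-1 + s^-1 = 1 -> 0 < a -> 0 < b -> 0 <= x -> 0 <= y ->
  x * y <= a * b * ((r^-1 / a `^ r) * x `^ r + (s^-1 / b `^ s) * y `^ s).
Proof.
move=> r0 s0 rs a0 b0 x0 y0.
have := conjugate_powR (divr_ge0 x0 (ltW a0)) (divr_ge0 y0 (ltW b0)) r0 s0 rs.
rewrite !powR_div ?(ltW a0) ?(ltW b0)// => h.
have := ler_wpM2l (ltW (mulr_gt0 a0 b0)) h.
have -> : a * b * (x / a * (y / b)) = x * y by field; rewrite !gt_eqF.
move=> h'; apply: (le_trans h'); rewrite le_eqVlt; apply/orP; left; apply/eqP.
by congr (_ * (_ + _)); ring.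
Qed.

Section Moments.
Variables (R : realType) (n : nat) (XX : {set cube 'I_n}).
Variables (mu : cube 'I_n -> R).
Hypothesis law : is_law XX mu.
Implicit Types (f g h : cube 'I_n -> R) (r s t : R).

Let mu_ge0 x : 0 <= mu x. Proof. by have [] := law. Qed.

Local Notation E := (mean XX mu).
Local Notation N := (Lr_norm XX mu).

Lemma eq_mean f g : {in XX, f =1 g} -> E f = E g.
Proof. by move=> fg; apply: eq_bigr => x /fg ->. Qed.

Lemma ler_mean f g : {in XX, forall x, f x <= g x} -> E f <= E g.
Proof. by move=> fg; apply: ler_sum => x xX; rewrite ler_wpM2r// fg. Qed.

Lemma mean_ge0 f : {in XX, forall x, 0 <= f x} -> 0 <= E f.
Proof. by move=> f0; apply: sumr_ge0 => x xX; rewrite mulr_ge0// f0. Qed.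

Lemma meanD f g : E (fun x => f x + g x) = E f + E g.
Proof. by rewrite -big_split/=; apply: eq_bigr => x _; rewrite mulrDl. Qed.

Lemma meanZ c f : E (fun x => c * f x) = c * E f.
Proof. by rewrite /mean mulr_sumr; apply: eq_bigr => x _; rewrite mulrA. Qed.

Lemma mean_cst c : E (fun=> c) = c.
Proof.
rewrite /mean -mulr_sumr; have [_ muN mu1] := law.
rewrite -[RHS]mulr1 -mu1 [in RHS](bigID (mem XX))/= [X in _ = _ * (_ + X)]big1 ?addr0//.
Qed.

(** Jensen, by averaging the tangent at the mean. *)
Lemma powR_mean_le s f : 1 <= s -> {in XX, forall x, 0 <= f x} ->
  E f `^ s <= E (fun x => f x `^ s).
Proof.
move=> s1 f0; set m := E f.
apply: (@le_trans _ _ (E (fun x =>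
  (m `^ s - s * m `^ (s - 1) * m) + s * m `^ (s - 1) * f x))).
  by rewrite meanD mean_cst meanZ -/m subrK.
apply: ler_mean => x xX; have := powR_ge_tangent s1 (mean_ge0 f0) (f0 x xX).
by rewrite -/m; lra.
Qed.

Lemma Lr_norm_ge0 r f : 0 <= N r f.
Proof. exact: powR_ge0. Qed.

Lemma Lr_norm_powR r f : 0 < r -> N r f `^ r = E (fun x => `|f x| `^ r).
Proof.
move=> r0; rewrite /Lr_norm -powRrM mulVf ?gt_eqF// powRr1//.
by apply: mean_ge0 => x _; exact: powR_ge0.
Qed.

Lemma Lr_norm_homo f s t : 0 < s -> s <= t -> N s f <= N t f.
Proof.
move=> s0 st; have t0 : 0 < t by exact: lt_le_trans st.
have st1 : 1 <= t / s by rewrite ler_pdivlMr// mul1r.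
have := @powR_mean_le (t / s) (fun x => `|f x| `^ s) st1 (fun x _ => powR_ge0 _ _).
rewrite -(Lr_norm_powR f s0).
have -> : E (fun x => (`|f x| `^ s) `^ (t / s)) = N t f `^ t.
  rewrite (Lr_norm_powR f t0); apply: eq_mean => x _.
  by rewrite -powRrM mulrCA divff ?gt_eqF// mulr1.
move: (N s f) (N t f) (Lr_norm_ge0 s f) (Lr_norm_ge0 t f) => a b a0 b0.
rewrite -powRrM mulrCA divff ?gt_eqF// mulr1 => ab.
rewrite leNgt; apply/negP => /(gt0_ltr_powR t0 b0 a0).
by rewrite ltNge ab.
Qed.

(** Young's inequality, scaled by the two norms, is averaged. If a norm is 0, the corresponding
    function vanishes wherever [mu] does not, and the left-hand side is 0. *)
Lemma mean_hoelder f g r s : 0 < r -> 0 < s -> r^-1 + s^-1 = 1 ->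
  {in XX, forall x, 0 <= f x} -> {in XX, forall x, 0 <= g x} ->
  E (fun x => f x * g x) <=
  E (fun x => f x `^ r) `^ r^-1 * E (fun x => g x `^ s) `^ s^-1.
Proof.
move=> r0 s0 rs f0 g0.
have E_ge0 h u : 0 <= E (fun x => h x `^ u) by apply: mean_ge0 => x _; exact: powR_ge0.
have null h u x : 0 < u -> {in XX, forall x, 0 <= h x} ->
    E (fun x => h x `^ u) = 0 -> x \in XX -> h x * mu x = 0.
  move=> u0 h0 /psumr_eq0P h_eq0 xX.
  have /eqP := h_eq0 (fun y _ => mulr_ge0 (powR_ge0 _ _) (mu_ge0 y)) x xX.
  by rewrite mulf_eq0 powR_eq0 (gt_eqF u0) andbT -mulf_eq0 => /eqP.
have [A0|A0] := eqVneq (E (fun x => f x `^ r)) 0.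
  rewrite [X in X <= _]big1 ?mulr_ge0 ?powR_ge0// => x xX.
  by rewrite mulrAC (null f r x r0 f0 A0 xX) mul0r.
have [B0|B0] := eqVneq (E (fun x => g x `^ s)) 0.
  rewrite [X in X <= _]big1 ?mulr_ge0 ?powR_ge0// => x xX.
  by rewrite -mulrA (null g s x s0 g0 B0 xX) mulr0.
have A1 : 0 < E (fun x => f x `^ r) by rewrite lt0r A0 E_ge0.
have B1 : 0 < E (fun x => g x `^ s) by rewrite lt0r B0 E_ge0.
set A := E (fun x => f x `^ r) in A1 *; set B := E (fun x => g x `^ s) in B1 *.
have AE : E (fun x => f x `^ r) = A := erefl.
have BE : E (fun x => g x `^ s) = B := erefl.
clearbody A B; clear A0 B0 null E_ge0.
pose a := A `^ r^-1; pose b := B `^ s^-1; rewrite -/a -/b.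
have aE0 : a = A `^ r^-1 := erefl; have bE0 : b = B `^ s^-1 := erefl.
clearbody a b.
have a0 : 0 < a by rewrite aE0 powR_gt0.
have b0 : 0 < b by rewrite bE0 powR_gt0.
have aE : a `^ r = A by rewrite aE0 -powRrM mulVf ?gt_eqF// powRr1// ltW.
have bE : b `^ s = B by rewrite bE0 -powRrM mulVf ?gt_eqF// powRr1// ltW.
have key x : x \in XX ->
    f x * g x <= a * b * ((r^-1 / A) * f x `^ r + (s^-1 / B) * g x `^ s).
  by move=> xX; rewrite -aE -bE; exact: young_scaled (f0 x xX) (g0 x xX).
apply: le_trans (ler_mean key) _; rewrite meanZ meanD !meanZ AE BE.
by rewrite (divfK (lt0r_neq0 A1)) (divfK (lt0r_neq0 B1)) rs mulr1.
Qed.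

End Moments.

Lemma powR_increment_le (R : realType) (r a b : R) : 2 <= r -> 0 <= b -> b <= a ->
  (a - b) * (a `^ (r - 1) - b `^ (r - 1)) <= (r - 1) * (a `^ (r - 2) * (a - b) ^+ 2).
Proof.
move=> r2 b0 ba; have r1 : 1 <= r - 1 by lra.
have := powR_ge_tangent r1 (le_trans b0 ba) b0.
rewrite (_ : r - 1 - 1 = r - 2); last by lra.
move: (a `^ (r - 1)) (b `^ (r - 1)) (a `^ (r - 2)) => X Y Z h.
have ab : 0 <= a - b by lra.
have h' : X - Y <= (r - 1) * Z * (a - b) by lra.
have -> : (r - 1) * (Z * (a - b) ^+ 2) = (a - b) * ((r - 1) * Z * (a - b)) by ring.
exact: ler_wpM2l.
Qed.

(* From [m_r^r <= m_{r-1}^r + (r-1) m_r^{r-2} v^2 / rho0] to the growth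
   [m_r^2 = O(r)], using [(1 - 1/r)^{r/2} <= e^{-1/2}]. *)
Lemma moment_recursion (R : realType) (r K rho0 l m v : R) : 2 <= r -> 0 < rho0 ->
  0 <= l -> 0 <= m -> 0 <= v -> 0 < K ->
  (K * rho0)^-1 < 1 - expR (- (1 / 2)) ->
  m `^ r <= l `^ r + (r - 1) / rho0 * (m `^ (r - 2) * v ^+ 2) ->
  l ^+ 2 <= K * (r - 1) * v ^+ 2 ->
  m ^+ 2 <= K * r * v ^+ 2.
Proof.
move=> r2 rho0_gt0 l0 m0 v0 K0 Krho rec lv; rewrite leNgt; apply/negP => mv.
have r0 : 0 < r by lra.
have mgt0 : 0 < m.
  rewrite lt0r m0 andbT; apply/eqP => mE; move: mv; rewrite mE expr0n/= ltNge.
  by rewrite !mulr_ge0 ?sqr_ge0// ltW.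
have m2 : 0 < m ^+ 2 by rewrite exprn_gt0.
(* The negated claim reads K r q < 1. It gives (l/m)^2 <= K (r - 1) q <= 1 - 1/r <= exp(-1/r). *)
pose q := v ^+ 2 / m ^+ 2.
have q0 : 0 <= q by rewrite divr_ge0 ?sqr_ge0.
have Kq : K * r * q < 1 by rewrite /q mulrA ltr_pdivrMr// mul1r.
have ratio : (l / m) ^+ 2 <= expR (- r^-1).
  rewrite expr_div_n ler_pdivrMr//; apply: (le_trans lv).
  have -> : K * (r - 1) * v ^+ 2 = K * (r - 1) * q * m ^+ 2.
    by rewrite -[RHS]mulrA divfK// gt_eqF.
  rewrite ler_pM2r//; have := expR_ge1Dx (- r^-1); apply: le_trans.
  have -> : 1 + - r^-1 = (r - 1) / r by field; rewrite gt_eqF.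
  rewrite ler_pdivlMr//.
  have := ler_wpM2r (_ : 0 <= r - 1) (ltW Kq); rewrite mul1r.
  have r1 : 0 <= r - 1 by lra.
  by move=> /(_ r1); lra.
have pow : (l / m) `^ r <= expR (- (1 / 2)).
  have lm0 : 0 <= l / m by rewrite divr_ge0.
  have -> : (l / m) `^ r = ((l / m) ^+ 2) `^ (r / 2).
    by rewrite -powR_mulrn// -powRrM; congr (_ `^ _); field.
  have r20 : 0 <= r / 2 by lra.
  have := ge0_ler_powR r20 _ _ ratio; rewrite !nnegrE sqr_ge0 expR_ge0 => /(_ isT isT).
  move=> /le_trans; apply; rewrite /powR gt_eqF ?expR_gt0// expRK ler_expR.
  by rewrite le_eqVlt; apply/orP; left; apply/eqP; field; rewrite gt_eqF.
have mr : 0 < m `^ r by exact: powR_gt0.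
(* The recursion divided by m^r. Its first term is at most e^(-1/2) and its second at most 1 / (K
   rho0), against the hypothesis on [K]. *)
have : 1 <= (l / m) `^ r + (r - 1) / rho0 * q.
  rewrite powR_div// -(ler_pM2r mr) mul1r mulrDl divfK ?gt_eqF//.
  apply: (le_trans rec); rewrite lerD2l -[leRHS]mulrA ler_wpM2l//.
    by apply: divr_ge0; [lra | exact: ltW].
  rewrite powRB ?(gt_eqF mgt0) ?implybT// (powR_mulrn 2)// /q.
  by rewrite le_eqVlt; apply/orP; left; apply/eqP; field; rewrite gt_eqF.
suff : (r - 1) / rho0 * q <= (K * rho0)^-1 by lra.
rewrite invfM mulrAC ler_pM2r ?invr_gt0// -(ler_pM2l K0) divff ?gt_eqF//.
by have := mulr_ge0 (ltW K0) q0; lra.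
Qed.

(** * From the entropy inequality of a reversible kernel to moment bounds *)

Section KernelMoments.
Variables (R : realType) (n : nat) (XX : {set cube 'I_n}).
Variables (mu : cube 'I_n -> R) (Q : cube 'I_n -> cube 'I_n -> R) (rho0 : R).
Hypotheses (law : is_law XX mu) (ker : is_kernel XX Q) (rev : reversible XX mu Q).
Hypothesis rho0_gt0 : 0 < rho0.
Hypothesis entropy_le : forall p f, 1 < p -> p <= 2 -> {in XX, forall x, 0 <= f x} ->
  rho0 * (mean XX mu (fun x => f x `^ p) - mean XX mu f `^ p)
  <= dirichlet XX mu Q f (fun x => f x `^ (p - 1)).
Implicit Types (f g h : cube 'I_n -> R) (r s t : R).

Let mu_ge0 x : 0 <= mu x. Proof. by have [] := law. Qed.

(** By reversibility [a x y] and [a y x] contribute equally, which absorbs the factor 1/2. This is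
    how one-sided differences enter. *)
Lemma dirichlet_le g h (a : cube 'I_n -> cube 'I_n -> R) :
  (forall x y, (g y - g x) * (h y - h x) <= a x y + a y x) ->
  dirichlet XX mu Q g h <= mean XX mu (fun x => \sum_(y in XX) a x y * Q x y).
Proof.
move=> gha; rewrite /dirichlet ler_pdivrMl//.
have -> : 2 * mean XX mu (fun x => \sum_(y in XX) a x y * Q x y)
  = \sum_(x in XX) \sum_(y in XX) (a x y + a y x) * Q x y * mu x.
  rewrite mulr2n mulrDl mul1r.
  have mE : mean XX mu (fun x => \sum_(y in XX) a x y * Q x y)
      = \sum_(x in XX) \sum_(y in XX) a x y * Q x y * mu x.
    by apply: eq_bigr => x _; rewrite mulr_suml.
  rewrite {2}mE exchange_big/= mE -big_split/=; apply: eq_bigr => x xX.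
  rewrite -big_split/=; apply: eq_bigr => y yX.
  by rewrite -[X in _ + X]mulrA rev// mulrA -!mulrDl.
apply: ler_sum => x xX; apply: ler_sum => y yX.
by rewrite !ler_wpM2r// ker.
Qed.

Lemma dirichlet_powR_ge0 q f : 0 <= q -> {in XX, forall x, 0 <= f x} ->
  0 <= dirichlet XX mu Q f (fun x => f x `^ q).
Proof.
move=> q0 f0; apply: mulr_ge0; first by rewrite invr_ge0.
apply: sumr_ge0 => x xX; apply: sumr_ge0 => y yX.
apply: mulr_ge0 => //; apply: mulr_ge0; last exact: ker.
by apply: gap_ge0; rewrite ?f0.
Qed.

Lemma neg_partE (t : R) : neg_part t ^+ 2 + neg_part (- t) ^+ 2 = t ^+ 2.
Proof.
rewrite /neg_part opprK; case/orP: (le_total 0 t) => t0.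
  by rewrite [Num.max (- t) 0]max_r ?oppr_le0// max_l// expr0n add0r.
by rewrite [Num.max (- t) 0]max_l ?oppr_ge0// max_r// expr0n addr0 sqrrN.
Qed.

Lemma pos_part_sub_le (a b : R) : pos_part a - pos_part b <= neg_part (b - a).
Proof.
rewrite /pos_part /neg_part opprB lerBlDr.
have b0 : b <= Num.max b 0 by rewrite le_max lexx.
have b1 : 0 <= Num.max b 0 by rewrite le_max lexx orbT.
have d0 : a - b <= Num.max (a - b) 0 by rewrite le_max lexx.
have d1 : 0 <= Num.max (a - b) 0 by rewrite le_max lexx orbT.
move: (Num.max b 0) (Num.max (a - b) 0) b0 b1 d0 d1 => B D b0 b1 d0 d1.
by rewrite ge_max; apply/andP; split; lra.
Qed.

Section OneFunction.
Variable f : cube 'I_n -> R.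
Let h x := pos_part (f x - mean XX mu f).
Let V x := \sum_(y in XX) neg_part (f y - f x) ^+ 2 * Q x y.
Let N := Lr_norm XX mu.

Let h_ge0 x : 0 <= h x.
Proof. by rewrite /h /pos_part le_max lexx orbT. Qed.

Let V_ge0 : {in XX, forall x, 0 <= V x}.
Proof. by move=> x xX; apply: sumr_ge0 => y yX; rewrite mulr_ge0 ?sqr_ge0 ?ker. Qed.

Let normh r : 0 < r -> N r h `^ r = mean XX mu (fun x => h x `^ r).
Proof.
move=> r0; rewrite (Lr_norm_powR law h r0); apply: eq_mean => x _.
by rewrite ger0_norm.
Qed.

Let meanV : mean XX mu V = N 2 (fun x => Num.sqrt (V x)) ^+ 2.
Proof.
rewrite -powR_mulrn ?Lr_norm_ge0// (Lr_norm_powR law _ (ltr0Sn _ 1)).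
apply: eq_mean => x xX; rewrite ger0_norm ?sqrtr_ge0// powR_mulrn ?sqrtr_ge0//.
by rewrite sqr_sqrtr// V_ge0.
Qed.

(** The case p = 2 is a Poincaré inequality. It is applied to [f] shifted by a constant to be
    nonnegative, which changes neither the variance nor the differences. *)
Lemma variance_bound : rho0 * N 2 h ^+ 2 <= N 2 (fun x => Num.sqrt (V x)) ^+ 2.
Proof.
pose c := \sum_x `|f x|; pose F x := f x + c.
have F0 x : 0 <= F x.
  have : - f x <= c; last by rewrite /F; lra.
  by rewrite /c (bigD1 x)//= ler_wpDr ?sumr_ge0// -normrN ler_norm.
have EF : mean XX mu F = mean XX mu f + c by rewrite /F meanD (mean_cst law).
have FE x : F x = f x + c by [].
clearbody F.
have EF0 : 0 <= mean XX mu F by apply: (mean_ge0 law) => x _.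
have h2 : N 2 h ^+ 2 <= mean XX mu (fun x => F x ^+ 2) - mean XX mu F ^+ 2.
  rewrite -powR_mulrn ?Lr_norm_ge0// normh//.
  have -> : mean XX mu (fun x => F x ^+ 2) - mean XX mu F ^+ 2
      = mean XX mu (fun x => F x ^+ 2 + (mean XX mu F ^+ 2 + - (2 * mean XX mu F) * F
        x)).
    by rewrite !meanD (mean_cst law) meanZ; ring.
  apply: (ler_mean law) => x _; rewrite powR_mulrn//.
  have -> : F x ^+ 2 + (mean XX mu F ^+ 2 + - (2 * mean XX mu F) * F x)
      = (f x - mean XX mu f) ^+ 2 by rewrite EF FE; ring.
  rewrite /h /pos_part; case/orP: (le_total 0 (f x - mean XX mu f)) => t0.
    by rewrite max_l.
  by rewrite max_r// expr0n sqr_ge0.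
have := @entropy_le 2 F (ltr1n _ 2) (lexx _) (fun x _ => F0 x).
rewrite powR_mulrn// (@eq_mean _ _ _ _ (fun x => F x `^ 2) (fun x => F x ^+ 2));
  last first.
  by move=> x _; rewrite powR_mulrn.
move=> ent; apply: le_trans (ler_wpM2l (ltW rho0_gt0) h2) _.
apply: (le_trans ent); rewrite -meanV.
apply: (@dirichlet_le _ _ (fun x y => neg_part (f y - f x) ^+ 2)) => x y.
have -> : 2 - 1 = 1 :> R by lra.
rewrite !powRr1// !FE -[f x - f y]opprB neg_partE le_eqVlt; apply/orP; left.
by apply/eqP; ring.
Qed.

(** Hölder with the exponents r/(r-2) and r/2; the case r = 2, where the first is infinite, is an
    equality. *)
Lemma hoelder_bound r : 2 <= r ->
  mean XX mu (fun x => h x `^ (r - 2) * V x)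
  <= N r h `^ (r - 2) * N r (fun x => Num.sqrt (V x)) ^+ 2.
Proof.
move=> r2; have r0 : 0 < r by lra.
have [r2E|r2n] := eqVneq r 2.
  rewrite r2E subrr powRr0 mul1r -meanV le_eqVlt; apply/orP; left; apply/eqP.
  by apply: eq_mean => x _; rewrite powRr0 mul1r.
have r2' : 0 < r - 2 by rewrite subr_gt0 lt_neqAle eq_sym r2n.
have s0 : 0 < r / (r - 2) by rewrite divr_gt0.
have t0 : 0 < r / 2 by lra.
have st : (r / (r - 2))^-1 + (r / 2)^-1 = 1 by field; rewrite !gt_eqF.
have := mean_hoelder law s0 t0 st (f := fun x => h x `^ (r - 2)) (g := V)
  (fun x _ => powR_ge0 _ _) V_ge0.
rewrite (@eq_mean _ _ _ _ (fun x => (h x `^ (r - 2)) `^ (r / (r - 2)))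
  (fun x => h x `^ r)); last first.
  by move=> x _; rewrite -powRrM; congr (_ `^ _); field; rewrite gt_eqF.
rewrite (@eq_mean _ _ _ _ (fun x => V x `^ (r / 2))
  (fun x => `|Num.sqrt (V x)| `^ r)); last first.
  move=> x xX; rewrite ger0_norm ?sqrtr_ge0// -powR12_sqrt ?V_ge0// -powRrM.
  by congr (_ `^ _); field.
rewrite -(normh r0).
rewrite -(Lr_norm_powR law (fun x => Num.sqrt (V x)) r0).
rewrite -/N.
have := Lr_norm_ge0 XX mu r (fun x => Num.sqrt (V x)).
rewrite -/N.
move: (N r h) (N r (fun x => Num.sqrt (V x))) => a b b0; rewrite -!powRrM.
have -> : r * (r / (r - 2))^-1 = r - 2 by field; rewrite !gt_eqF.
have -> : r * (r / 2)^-1 = 2 by field; rewrite gt_eqF.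
by rewrite powR_mulrn.
Qed.

(** Apply the entropy inequality with p = r/(r-1) to h^(r-1). Since (r-1)(p-1) = 1, the second
    argument of the Dirichlet form is [h] itself. *)
Lemma entropy_recursion r : 2 <= r ->
  N r h `^ r <= N (r - 1) h `^ r
    + (r - 1) / rho0 * (N r h `^ (r - 2) * N r (fun x => Num.sqrt (V x)) ^+ 2).
Proof.
move=> r2; have r0 : 0 < r by lra.
have r1 : 0 < r - 1 by lra.
pose p := r / (r - 1).
have p1 : 1 < p by rewrite /p ltr_pdivlMr//; lra.
have p2 : p <= 2 by rewrite /p ler_pdivrMr//; lra.
have := @entropy_le p (fun x => h x `^ (r - 1)) p1 p2 (fun x _ => powR_ge0 _ _).
rewrite -(normh r1) -powRrM.
have -> : (r - 1) * p = r by rewrite /p; field; rewrite gt_eqF.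
rewrite (@eq_mean _ _ _ _ (fun x => (h x `^ (r - 1)) `^ p) (fun x => h x `^ r));
  last first.
  by move=> x _; rewrite -powRrM; congr (_ `^ _); rewrite /p; field; rewrite gt_eqF.
rewrite -(normh r0) => ent.
have dir : dirichlet XX mu Q (fun x => h x `^ (r - 1)) (fun x =>
  (h x `^ (r - 1)) `^ (p - 1))
   <= (r - 1) * (N r h `^ (r - 2) * N r (fun x => Num.sqrt (V x)) ^+ 2).
  apply: le_trans (ler_wpM2l (ltW r1) (hoelder_bound r2)).
  rewrite -meanZ.
  apply: le_trans (@dirichlet_le _ _ (fun x y =>
    (r - 1) * (h x `^ (r - 2) * neg_part (f y - f x) ^+ 2)) _) _; last first.
    rewrite le_eqVlt; apply/orP; left; apply/eqP; apply: eq_mean => x _.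
    by rewrite /V !mulr_sumr; apply: eq_bigr => y _; rewrite !mulrA.
  move=> x y; rewrite -![(h _ `^ (r - 1)) `^ (p - 1)]powRrM.
  have -> : (r - 1) * (p - 1) = 1 by rewrite /p; field; rewrite gt_eqF.
  rewrite !powRr1//.
  have nonneg x' y' : 0 <= (r - 1) * (h x' `^ (r - 2) * neg_part (f y' - f x') ^+ 2).
    by rewrite mulr_ge0 ?(ltW r1)// mulr_ge0 ?powR_ge0 ?sqr_ge0.
  (* Each pair is charged to the endpoint where [h] is larger, so only decreases of [f] appear. *)
  have increment x' y' : h y' <= h x' ->
      (h x' - h y') * (h x' `^ (r - 1) - h y' `^ (r - 1))
      <= (r - 1) * (h x' `^ (r - 2) * neg_part (f y' - f x') ^+ 2).
    move=> yx; apply: le_trans (powR_increment_le r2 (h_ge0 y') yx) _.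
    rewrite ler_wpM2l ?(ltW r1)// ler_wpM2l ?powR_ge0// ler_sqr ?nnegrE ?subr_ge0//.
      have -> : f y' - f x' = (f y' - mean XX mu f) - (f x' - mean XX mu f) by ring.
      exact: pos_part_sub_le.
    by rewrite /neg_part le_max lexx orbT.
  have [yx|xy] := leP (h y) (h x).
    rewrite -[leLHS]mulrNN !opprB [leLHS]mulrC; apply: le_trans (increment _ _ yx) _.
    by rewrite lerDl; exact: nonneg.
  rewrite [leLHS]mulrC; apply: le_trans (increment _ _ (ltW xy)) _.
  by rewrite lerDr; exact: nonneg.
rewrite -lerBlDl -[(r - 1) / rho0]mulrC -mulrA ler_pdivlMl//.
exact: le_trans ent dir.
Qed.

Let K := 3 * Num.sqrt (expR 1) / (rho0 * (Num.sqrt (expR 1) - 1)).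

Let sqrt_e : Num.sqrt (expR 1) = expR (1 / 2) :> R.
Proof.
have -> : 1 = 1 / 2 + 1 / 2 :> R by field.
by rewrite expRD -expr2 sqrtr_sqr ger0_norm ?expR_ge0// -splitr.
Qed.

Let sqrt_e_gt1 : 1 < Num.sqrt (expR 1) :> R.
Proof. by rewrite sqrt_e expR_gt1; lra. Qed.

Let K_gt0 : 0 < K.
Proof.
have e1 := sqrt_e_gt1; rewrite /K divr_gt0 ?mulr_gt0 ?subr_gt0//.
by apply: lt_trans e1.
Qed.

(** In fact 1 / (K rho0) is a third of the right-hand side. *)
Let K_rho0 : (K * rho0)^-1 < 1 - expR (- (1 / 2)).
Proof.
have := sqrt_e_gt1; rewrite /K expRN -sqrt_e; move: (Num.sqrt _) => e e1.
have e0 : 0 < e by lra.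
have -> : (3 * e / (rho0 * (e - 1)) * rho0)^-1 = (1 - e^-1) / 3.
  by field; rewrite !gt_eqF ?subr_gt0.
have : e^-1 < 1 by rewrite invf_lt1.
by lra.
Qed.

(** Induction in unit steps of [s], the variance bound covering 1 <= s <= 2. The separate exponent
    [t] lets the hypothesis at s - 1 be used with the norm of order s that the recursion
    supplies. *)
Lemma moment_growth (b : nat) s t : 1 <= s -> s <= b.+2%:R -> s <= t -> 2 <= t ->
  N s h ^+ 2 <= K * s * N t (fun x => Num.sqrt (V x)) ^+ 2.
Proof.
have N_homo g u w : 0 < u -> u <= w -> N u g ^+ 2 <= N w g ^+ 2.
  move=> u0 uw; have := Lr_norm_homo law g u0 uw.
  have := Lr_norm_ge0 XX mu u g; have := Lr_norm_ge0 XX mu w g.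
  by rewrite -/N; move: (N u g) (N w g) => a c c0 a0 ac; rewrite ler_sqr.
elim: b s t => [|b IHb] s t s1 sb st t2; have s0 : 0 < s by lra.
  apply: le_trans (N_homo h s 2 s0 sb) _.
  apply: (@le_trans _ _ (rho0^-1 * N t (fun x => Num.sqrt (V x)) ^+ 2)).
    rewrite ler_pdivlMl//; apply: le_trans variance_bound _; exact: N_homo.
  apply: ler_wpM2r; first exact: sqr_ge0.
  apply: (@le_trans _ _ K); last by rewrite ler_peMr// ltW.
  have K1 : (K * rho0)^-1 < 1 by have := K_rho0; have := expR_gt0 (- (1 / 2) : R); lra.
  have : 1 < K * rho0 by rewrite -invf_lt1// mulr_gt0.
  by rewrite -div1r ler_pdivrMr// => /ltW.
have [s2|s2] := leP s 2.
  by apply: (IHb s t) => //; apply: le_trans s2 _; rewrite ler_nat.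
have s2' := ltW s2.
apply: (@le_trans _ _ (K * s * N s (fun x => Num.sqrt (V x)) ^+ 2)); last first.
  apply: ler_wpM2l; first by rewrite mulr_ge0 ?(ltW K_gt0) ?(ltW s0).
  exact: N_homo.
apply: (moment_recursion s2' rho0_gt0 (Lr_norm_ge0 _ _ _ _) (Lr_norm_ge0 _ _ _ _)
  (Lr_norm_ge0 _ _ _ _) K_gt0 K_rho0 (entropy_recursion s2')).
apply: IHb => //; [lra | | lra].
by move: sb; rewrite -[in X in X -> _]natr1; lra.
Qed.

Lemma moment_bound_one r : 2 <= r ->
  N r h <= moment_const rho0 * Num.sqrt r * N r (fun x => Num.sqrt (V x)).
Proof.
move=> r2; have r0 : 0 < r by lra.
have := @moment_growth (Num.bound r) r r.
have -> : 1 <= r by lra.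
have -> : r <= (Num.bound r).+2%:R.
  have := archi_boundP (ltW r0); rewrite -[X in _ <= X]natr1 -natr1; lra.
rewrite lexx r2 => /(_ isT isT isT isT) growth.
rewrite -ler_sqr ?nnegrE ?mulr_ge0 ?sqrtr_ge0 ?Lr_norm_ge0//.
by rewrite !exprMn !sqr_sqrtr ?(ltW r0) ?(ltW K_gt0).
Qed.

End OneFunction.

(** The Dirichlet form is nonnegative and p/2 >= 1/6, so the constant rho0 / 6 follows with room to
    spare. *)
Lemma beckner_and_moments_of_entropy : beckner_and_moments XX mu Q rho0.
Proof.
split=> [p p1 p2|r r2 f]; last exact: moment_bound_one.
exists (rho0 / 6) => // f f0.
have p10 : 0 <= p - 1 by lra.
have := dirichlet_powR_ge0 p10 f0; have := entropy_le p1 p2 f0.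
move: (dirichlet _ _ _ _ _) (_ - _) => D B h1 D0.
have := mulr_ge0 p10 D0; lra.
Qed.

End KernelMoments.

(** * Kernels from the flow *)

Lemma SCP_flow (R : realType) (n : nat) (mu : cube 'I_n -> R) :
  (forall x, 0 <= mu x) -> SCP mu ->
  exists w, [/\ flow mu w, forall x, \sum_y w x y <= n%:R * mu x
    & forall k, (forall x, mu x != 0 -> (\sum_(i < n) x i)%N = k) ->
      forall x, \sum_y w x y <= 2 * k%:R * mu x].
Proof.
move=> mu0 scp.
have cardT : #|~: (finset.set0 : {set 'I_n})| = n by rewrite finset.setC0 cardsT
  card_ord.
have [w] := flow_exists [ffun=> false] mu0 scp cardT.
have -> : pinned mu finset.set0 [ffun=> false] = mu.
  by apply/funext => x; rewrite /pinned (introT (agreeP _ _ _))// => i; rewrite inE.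
move=> [fl rate hom]; exists w; split => // k homk; apply: hom => x /homk <-.
by apply: eq_bigl => i; rewrite !inE.
Qed.

(** Extend [f] by 0 outside [XX], where [mu] and hence [w] vanish, and compare energy and Dirichlet
    form term by term; this is legitimate because the gaps are nonnegative. *)
Lemma flow_dirichlet (R : realType) (n : nat) (XX : {set cube 'I_n})
    (mu : cube 'I_n -> R) (Q w : cube 'I_n -> cube 'I_n -> R) (rho0 p : R)
    (f : cube 'I_n -> R) :
  is_law XX mu -> flow mu w -> 0 < rho0 ->
  (forall x y, x \in XX -> y \in XX -> rho0 * w x y <= Q x y * mu x) ->
  1 < p -> p <= 2 -> {in XX, forall x, 0 <= f x} ->
  rho0 * (mean XX mu (fun x => f x `^ p) - mean XX mu f `^ p)
  <= dirichlet XX mu Q f (fun x => f x `^ (p - 1)).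
Proof.
move=> [mu0 muN mu1] fl rho0_gt0 wQ p1 p2 f0.
pose g x := if x \in XX then f x else 0.
have g0 x : 0 <= g x by rewrite /g; case: ifP => // /f0.
have gE x : x \in XX -> g x = f x by rewrite /g => ->.
have sumE (F : R -> R) : \sum_x F (g x) * mu x = mean XX mu (fun x => F (f x)).
  rewrite (bigID (mem XX))/= [X in _ + X]big1 ?addr0 => [|x xX];
    last by rewrite muN ?mulr0.
  by apply: eq_bigr => x xX; rewrite gE.
have wN x y : x \notin XX -> w x y = 0.
  by move=> xX; apply: (flow_outside _ mu0 fl); exact: muN.
have := flow_entropy fl p1 p2 g0.
rewrite /entropy (sumE (fun t => t `^ p)) (sumE id) /mass mu1 mul1r divr1.
move=> /(ler_wpM2l (ltW rho0_gt0))/le_trans; apply.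
rewrite -energyZ /energy /dirichlet ler_wpM2l ?invr_ge0//.
rewrite (bigID (mem XX))/= [X in _ + X]big1 ?addr0; last first.
  by move=> x xX; rewrite big1// => y _; rewrite wN// !mulr0.
apply: ler_sum => x xX.
rewrite (bigID (mem XX))/= [X in _ + X]big1 ?addr0; last first.
  by move=> y yX; rewrite (flow_sym fl) wN// !mulr0.
apply: ler_sum => y yX; rewrite !gE// -[leRHS]mulrA ler_wpM2l ?wQ//.
by apply: gap_ge0; rewrite ?f0//; lra.
Qed.

(** A flip changes the number of ones by one. *)
Lemma differ_transp_sum (n : nat) (x y : cube 'I_n) :
  adj x y -> (\sum_(i < n) x i)%N = (\sum_(i < n) y i)%N -> differ_transp x y.
Proof.
case/orP => // /existsP[i /forallP xy] sumE; exfalso.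
have xyN j : j != i -> x j = y j.
  by move=> ji; have := xy j; rewrite (negPf ji) eqbF_neg negbK => /eqP.
have := xy i; rewrite eqxx eqb_id; move: sumE.
rewrite (bigD1 i)//= [RHS](bigD1 i)//= (eq_bigr _ (fun j ji =>
  congr1 nat_of_bool (xyN j ji))).
by move=> /addIn; case: (x i) (y i) => [] [].
Qed.

Section FlowKernel.
Variables (R : realType) (n : nat) (XX : {set cube 'I_n}).
Variables (mu : cube 'I_n -> R) (w : cube 'I_n -> cube 'I_n -> R) (c : R).
Hypotheses (law : is_law XX mu) (fl : flow mu w) (c_gt0 : 0 < c).
Hypothesis rate : forall x, \sum_y w x y <= c * mu x.

(** Where [mu x = 0], division by zero makes the rates 0. *)
Definition flow_kernel x y : R := w x y / (c * mu x).

Let mu_ge0 x : 0 <= mu x. Proof. by have [] := law. Qed.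

Lemma flow_kernelM x y : flow_kernel x y * mu x = w x y / c.
Proof.
have [mx|mx] := eqVneq (mu x) 0.
  by rewrite mx mulr0 (flow_outside y mu_ge0 fl mx) mul0r.
by rewrite /flow_kernel; field; rewrite mx gt_eqF.
Qed.

Lemma flow_kernel_ge0 : is_kernel XX flow_kernel.
Proof. by move=> x y _ _; rewrite divr_ge0 ?(flow_ge0 fl)// mulr_ge0 ?(ltW c_gt0). Qed.

Lemma flow_kernel_reversible : reversible XX mu flow_kernel.
Proof. by move=> x y _ _; rewrite !flow_kernelM (flow_sym fl). Qed.

Lemma flow_kernel_rate : exit_rate_le1 XX flow_kernel.
Proof.
move=> x _; apply: (@le_trans _ _ (\sum_y flow_kernel x y)).
  rewrite [leRHS](bigID (mem (XX :\ x)))/= lerDl sumr_ge0// => y _.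
  by rewrite divr_ge0 ?(flow_ge0 fl)// mulr_ge0 ?(ltW c_gt0).
rewrite -mulr_suml; have [mx|mx] := eqVneq (mu x) 0.
  by rewrite mx mulr0 invr0 mulr0.
by rewrite ler_pdivrMr ?mul1r// mulr_gt0// lt0r mx mu_ge0.
Qed.

Lemma flow_kernel_neq0 x y : flow_kernel x y != 0 ->
  [/\ adj x y, mu x != 0 & mu y != 0].
Proof.
rewrite mulf_eq0 negb_or => /andP[wxy _]; split; first exact: flow_adj fl x y wxy.
  by apply: contraNneq wxy => mx; rewrite (flow_outside y mu_ge0 fl mx).
by apply: contraNneq wxy => my; rewrite (flow_sym fl) (flow_outside x mu_ge0 fl my).
Qed.

Lemma flow_kernel_moments : beckner_and_moments XX mu flow_kernel (1 / c).
Proof.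
have c'_gt0 : 0 < 1 / c by rewrite divr_gt0.
apply: (beckner_and_moments_of_entropy law flow_kernel_ge0 flow_kernel_reversible
  c'_gt0).
move=> p f; apply: (flow_dirichlet law fl c'_gt0) => x y _ _.
by rewrite flow_kernelM mul1r mulrC.
Qed.

End FlowKernel.

Theorem corollary4p13 (R : realType) (n : nat) (XX : {set cube 'I_n})
    (mu : cube 'I_n -> R) (hmu : is_law XX mu) (hscp : SCP mu) :
  [/\
    (* (i) *)
    forall (Q : cube 'I_n -> cube 'I_n -> R) (rho0 : R),
      is_kernel XX Q -> reversible XX mu Q ->
      is_min_rate XX Q rho0 -> 0 < rho0 ->
      beckner_and_moments XX mu Q rho0,
    (* (ii) *)
    (0 < n)%N ->
      exists Q : cube 'I_n -> cube 'I_n -> R,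
        [/\ is_kernel XX Q, reversible XX mu Q,
            kernel_supported XX Q (@adj n), exit_rate_le1 XX Q
          & beckner_and_moments XX mu Q (1 / n%:R)]
  & (* (iii) *)
    forall k : nat, (1 <= k)%N ->
      (forall x, mu x != 0 -> (\sum_(i < n) x i)%N = k) ->
      exists Q : cube 'I_n -> cube 'I_n -> R,
        [/\ is_kernel XX Q, reversible XX mu Q,
            kernel_supported XX Q (@differ_transp n), exit_rate_le1 XX Q
          & beckner_and_moments XX mu Q (1 / (2 * k%:R))]].
Proof.
have mu_ge0 x : 0 <= mu x by have [] := hmu.
have [w [fl rate hom]] := SCP_flow mu_ge0 hscp.
split.
- move=> Q rho0 ker rev [min_le _] rho0_gt0.
  apply: (beckner_and_moments_of_entropy hmu ker rev rho0_gt0) => p f.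
  apply: (flow_dirichlet hmu fl rho0_gt0) => x y xX yX.
  have [->|wxy] := eqVneq (w x y) 0; first by rewrite mulr0 mulr_ge0// ker.
  (* Either Q_x(y) or Q_y(x) is at least [rho0]. It is paired with w <= mu x or w <= mu y
     respectively, and reversibility identifies the two products. *)
  have := min_le x y xX yX (flow_adj fl wxy); rewrite le_max => /orP[|] rate_xy.
    by apply: ler_pM => //;
      [exact: ltW | exact: flow_ge0 fl x y | exact: flow_le fl x y].
  rewrite rev//; apply: ler_pM => //; [exact: ltW | exact: flow_ge0 fl x y |].
  by rewrite (flow_sym fl); exact: flow_le fl y x.
- move=> n_gt0; have n0 : 0 < n%:R :> R by rewrite ltr0n.
  exists (flow_kernel mu w n%:R); split.
  + exact: flow_kernel_ge0 hmu fl n0.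
  + exact: flow_kernel_reversible hmu fl n0.
  + by move=> x y _ _ /(flow_kernel_neq0 hmu fl)[].
  + exact: flow_kernel_rate hmu fl n0 rate.
  + exact: flow_kernel_moments hmu fl n0.
move=> k k_gt0 homk.
have c0 : 0 < 2 * k%:R :> R by rewrite mulr_gt0 ?ltr0n.
exists (flow_kernel mu w (2 * k%:R)); split.
- exact: flow_kernel_ge0 hmu fl c0.
- exact: flow_kernel_reversible hmu fl c0.
(* A positive rate joins points of positive mass; both have [k] ones, which excludes a flip. *)
- move=> x y _ _ /(flow_kernel_neq0 hmu fl)[xy mx my].
  by apply: differ_transp_sum xy _; rewrite !homk.
- exact: flow_kernel_rate hmu fl c0 (hom k homk).
exact: flow_kernel_moments hmu fl c0.
Qed.
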